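(* Let $A,B$ be rings and $M$ a $(B,A)$-bimodule with $M_A$ finitely generated projective, $S=\mathrm{End}_A(M)$ and $\Sigma=M^*\otimes_BM$ the comatrix $A$-coring. If (i) $M$ is faithfully flat as a left $B$-module, or (ii) $M^*$ is faithfully flat as a right $B$-module, or (iii) ${}_BM_A$ is a separable bimodule, then $\Gamma_0:\mathrm{Inv}_B(S)\to\mathrm{Aut}_{A\text{-cor}}(\Sigma)$ is an isomorphism of groups.
   Context: $M^*=\mathrm{Hom}_A(M,A)$, an $(A,B)$-bimodule; $S=\mathrm{End}_A(M_A)$ acts on $M$ on the left and on $M^*$ on the right by composition; $i:B\to S$, $i(b)=(m\mapsto bm)$. $\Sigma=M^*\otimes_BM$ has comultiplication $\varphi\otimes m\mapsto\sum_k\varphi\otimes e_k\otimes_Ae_k^*\otimes m$ ($\{e_k,e_k^*\}$ a dual basis of $M_A$) and counit $\varphi\otimes m\mapsto\varphi(m)$; $\mathrm{Aut}_{A\text{-cor}}(\Sigma)$: invertible $A$-bimodule endomorphisms compatible with comultiplication and counit. $\mathrm{Inv}_B(S)$: group of invertible elements of the monoid of $B$-subbimodules of $S$ (product $IJ=\{\sum_kx_ky_k\}$, unit $i(B)$). For $I\in\mathrm{Inv}_B(S)$, $S\otimes_BI\to S$ (multiplication) is bijective; writing the preimage of $1$ as $\sum_jx_j\otimes y_j$, $\Gamma_0(I)(\varphi\otimes m)=\sum_j\varphi x_j\otimes y_j(m)$. The bimodule ${}_BM_A$ is separable (in the sense of Sugano) if the $B$-bimodule map $M\otimes_A\mathrm{Hom}_B(M,B)\to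 B$, $m\otimes f\mapsto f(m)$, is a split epimorphism of $B$-bimodules. *)

(* Defs.v *)
From HB Require Import structures.
From mathcomp Require Import all_boot all_algebra.
Set Implicit Arguments. Unset Strict Implicit. Unset Printing Implicit Defensive.
Import GRing.Theory.
Local Open Scope ring_scope.

Definition additive_map {U V : zmodType} (f : U -> V) : Prop :=
  forall x y, f (x + y) = f x + f y.

Definition addfun {U : Type} {V : zmodType} (f g : U -> V) : U -> V :=
  fun x => f x + g x.

Definition is_lmod {R : pzRingType} {N : zmodType} (act : R -> N -> N) : Prop :=
  [/\ forall r x y, act r (x + y) = act r x + act r y,
      forall r s x, act (r + s) x = act r x + act s x,
      forall r s x, act (r * s) x = act r (act s x)
    & forall x, act 1 x = x].

Definition is_rmod {R : pzRingType} {N : zmodType} (act : N -> R -> N) : Prop :=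
  [/\ forall r x y, act (x + y) r = act x r + act y r,
      forall r s x, act x (r + s) = act x r + act x s,
      forall r s x, act x (r * s) = act (act x r) s
    & forall x, act x 1 = x].

Definition is_bimod {B A : pzRingType} {M : zmodType}
  (lB : B -> M -> M) (rA : M -> A -> M) : Prop :=
  [/\ is_lmod lB, is_rmod rA & forall b m a, rA (lB b m) a = lB b (rA m a)].

Definition rlinA {A : pzRingType} {M : zmodType} (rA : M -> A -> M) (phi : M -> A) : Prop :=
  (forall m m', phi (m + m') = phi m + phi m') /\ (forall m a, phi (rA m a) = phi m * a).

Definition llinB {B : pzRingType} {M : zmodType} (lB : B -> M -> M) (f : M -> B) : Prop :=
  (forall m m', f (m + m') = f m + f m') /\ (forall b m, f (lB b m) = b * f m).

Definition endA {A : pzRingType} {M : zmodType} (rA : M -> A -> M) (s : M -> M) : Prop :=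
  (forall m m', s (m + m') = s m + s m') /\ (forall m a, s (rA m a) = rA (s m) a).

Definition fg_projective {A : pzRingType} {M : zmodType} (rA : M -> A -> M) : Prop :=
  exists (n : nat) (s : M -> 'I_n -> A) (p : ('I_n -> A) -> M),
    [/\ forall m m', s (m + m') = (fun i => s m i + s m' i),
        forall m a, s (rA m a) = (fun i => s m i * a),
        forall v w, p (fun i => v i + w i) = p v + p w,
        forall v a, p (fun i => v i * a) = rA (p v) a
      & forall m, p (s m) = m].

(* R-balanced maps on X x Y, where the right R-module X (resp. left R-module Y)
   is the set of elements of a type satisfying PX (resp. PY). *)
Definition balanced {R : pzRingType} {X Y : Type} (PX : X -> Prop) (PY : Y -> Prop)
  (addX : X -> X -> X) (addY : Y -> Y -> Y) (ractX : X -> R -> X) (lactY : R -> Y -> Y)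
  {Z : zmodType} (beta : X -> Y -> Z) : Prop :=
  [/\ forall x x' y, PX x -> PX x' -> PY y -> beta (addX x x') y = beta x y + beta x' y,
      forall x y y', PX x -> PY y -> PY y' -> beta x (addY y y') = beta x y + beta x y'
    & forall x r y, PX x -> PY y -> beta (ractX x r) y = beta x (lactY r y)].

Definition is_tensor {R : pzRingType} {X Y : Type} (PX : X -> Prop) (PY : Y -> Prop)
  (addX : X -> X -> X) (addY : Y -> Y -> Y) (ractX : X -> R -> X) (lactY : R -> Y -> Y)
  {T : zmodType} (tau : X -> Y -> T) : Prop :=
  balanced PX PY addX addY ractX lactY tau /\
  forall (Z : zmodType) (beta : X -> Y -> Z),
    balanced PX PY addX addY ractX lactY beta ->
    exists h : T -> Z,
      [/\ additive_map h,
          (forall x y, PX x -> PY y -> h (tau x y) = beta x y)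
        & forall h' : T -> Z, additive_map h' ->
            (forall x y, PX x -> PY y -> h' (tau x y) = beta x y) -> h' = h].

Definition ff_left {B : pzRingType} {Y : Type} (PY : Y -> Prop) (addY : Y -> Y -> Y)
  (lact : B -> Y -> Y) : Prop :=
  (forall (N1 N2 : zmodType) (r1 : N1 -> B -> N1) (r2 : N2 -> B -> N2),
     is_rmod r1 -> is_rmod r2 ->
     forall g : N1 -> N2, additive_map g -> (forall x b, g (r1 x b) = r2 (g x) b) ->
     injective g ->
     forall (T1 T2 : zmodType) (t1 : N1 -> Y -> T1) (t2 : N2 -> Y -> T2),
       is_tensor (fun _ => True) PY (@GRing.add N1) addY r1 lact t1 ->
       is_tensor (fun _ => True) PY (@GRing.add N2) addY r2 lact t2 ->
       forall h : T1 -> T2, additive_map h ->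
         (forall x y, PY y -> h (t1 x y) = t2 (g x) y) -> injective h) /\
  (forall (N : zmodType) (r : N -> B -> N), is_rmod r ->
     forall (T : zmodType) (t : N -> Y -> T),
       is_tensor (fun _ => True) PY (@GRing.add N) addY r lact t ->
       (forall z : T, z = 0) -> forall x : N, x = 0).

Definition ff_right {B : pzRingType} {X : Type} (PX : X -> Prop) (addX : X -> X -> X)
  (ract : X -> B -> X) : Prop :=
  (forall (N1 N2 : zmodType) (l1 : B -> N1 -> N1) (l2 : B -> N2 -> N2),
     is_lmod l1 -> is_lmod l2 ->
     forall g : N1 -> N2, additive_map g -> (forall b x, g (l1 b x) = l2 b (g x)) ->
     injective g ->
     forall (T1 T2 : zmodType) (t1 : X -> N1 -> T1) (t2 : X -> N2 -> T2),
       is_tensor PX (fun _ => True) addX (@GRing.add N1) ract l1 t1 ->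
       is_tensor PX (fun _ => True) addX (@GRing.add N2) ract l2 t2 ->
       forall h : T1 -> T2, additive_map h ->
         (forall x y, PX x -> h (t1 x y) = t2 x (g y)) -> injective h) /\
  (forall (N : zmodType) (l : B -> N -> N), is_lmod l ->
     forall (T : zmodType) (t : X -> N -> T),
       is_tensor PX (fun _ => True) addX (@GRing.add N) ract l t ->
       (forall z : T, z = 0) -> forall x : N, x = 0).

(* _B M_A is separable (Sugano): the B-bimodule map
   mu : M (x)_A Hom_B(M,B) -> B, m (x) f |-> f m, is a split epimorphism of
   B-bimodules. The B-bimodule structure of P = M (x)_A Hom_B(M,B) is
   b.(m (x) f).b' = (b m) (x) (f b'), with (f b')(m) = f(m) b'; maps out of P
   are described by their (unique) values on generators. *)
Definition separable_bimod {B A : pzRingType} {M : zmodType}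
  (lB : B -> M -> M) (rA : M -> A -> M) : Prop :=
  exists (P : zmodType) (pi : M -> (M -> B) -> P),
    is_tensor (fun _ => True) (llinB lB) (@GRing.add M) addfun rA
              (fun a f m => f (rA m a)) pi /\
    exists sigma : B -> P,
      [/\ additive_map sigma,
          (forall mu : P -> B, additive_map mu ->
             (forall m f, llinB lB f -> mu (pi m f) = f m) ->
             forall b, mu (sigma b) = b),
          (forall (b0 : B) (l : P -> P), additive_map l ->
             (forall m f, llinB lB f -> l (pi m f) = pi (lB b0 m) f) ->
             forall b, sigma (b0 * b) = l (sigma b))
        &
          (forall (b0 : B) (r : P -> P), additive_map r ->
             (forall m f, llinB lB f -> r (pi m f) = pi m (fun x => f x * b0)) ->
             forall b, sigma (b * b0) = r (sigma b))].

Definition subbimod {B A : pzRingType} {M : zmodType}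
  (lB : B -> M -> M) (rA : M -> A -> M) (I : (M -> M) -> Prop) : Prop :=
  [/\ forall s, I s -> endA rA s,
      I (fun _ => 0),
      forall s t, I s -> I t -> I (fun m => s m + t m),
      forall b s, I s -> I (fun m => lB b (s m))
    & forall b s, I s -> I (fun m => s (lB b m))].

Definition prod_sub {M : zmodType} (I J : (M -> M) -> Prop) : (M -> M) -> Prop :=
  fun s => exists (n : nat) (x y : 'I_n -> M -> M),
    [/\ forall k, I (x k), forall k, J (y k) & s = (fun m => \sum_(k < n) x k (y k m))].

Definition unit_sub {B : pzRingType} {M : zmodType} (lB : B -> M -> M) : (M -> M) -> Prop :=
  fun s => exists b, s = lB b.

Definition InvB {B A : pzRingType} {M : zmodType}
  (lB : B -> M -> M) (rA : M -> A -> M) (I : (M -> M) -> Prop) : Prop :=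
  subbimod lB rA I /\
  exists J, [/\ subbimod lB rA J,
                (forall s, prod_sub I J s <-> unit_sub lB s)
              & (forall s, prod_sub J I s <-> unit_sub lB s)].

(* Gamma_0(I) = f : for a family with sum_j x_j y_j = 1 (x_j in S, y_j in I),
   i.e. sum_j x_j (x) y_j is the preimage of 1 under S (x)_B I -> S,
   f (phi (x) m) = sum_j (phi o x_j) (x) y_j(m). *)
Definition Gamma0 {A : pzRingType} {M : zmodType} (rA : M -> A -> M)
  {T : zmodType} (tau : (M -> A) -> M -> T) (I : (M -> M) -> Prop) (f : T -> T) : Prop :=
  exists (n : nat) (x y : 'I_n -> M -> M),
    [/\ forall j, endA rA (x j),
        forall j, I (y j),
        forall m, \sum_(j < n) x j (y j m) = m,
        additive_map f
      & forall phi m, rlinA rA phi ->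
          f (tau phi m) = \sum_(j < n) tau (fun z => phi (x j z)) (y j m)].

Definition coring_aut {A : pzRingType} {T T2 : zmodType}
  (ltA : A -> T -> T) (rtA : T -> A -> T) (tau2 : T -> T -> T2)
  (Delta : T -> T2) (eps : T -> A) (f : T -> T) : Prop :=
  additive_map f /\ bijective f /\
  [/\ forall a t, f (ltA a t) = ltA a (f t),
      forall a t, f (rtA t a) = rtA (f t) a,
      forall t, eps (f t) = eps t
    &
      forall g : T2 -> T2, additive_map g ->
        (forall x y, g (tau2 x y) = tau2 (f x) (f y)) ->
        forall t, Delta (f t) = g (Delta t)].

(* Main.v *)
From HB Require Import structures.
Require Import Defs.
From mathcomp Require Import all_boot all_algebra.
From mathcomp Require Import boolp functions.
Set Implicit Arguments. Unset Strict Implicit. Unset Printing Implicit Defensive.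
Import GRing.Theory.
Local Open Scope ring_scope.

(** An automorphism [f] of [Sigma = M^* (x)_B M] is determined by the subbimodule
    [I_f = {s in S | f (phi s (x) m) = phi (x) s m for all phi, m}], and
    [f = Gamma_0 I] means that [I] is contained in [I_f].  If [h] is the inverse
    of [f], then every [s t] with [s] in [I_f] and [t] in [I_h] lies in
    [{z | phi z (x) m = phi (x) z m}], the equalizer of the two maps
    [S => S (x)_B S].  It remains to show that this equalizer is [B] and that
    [I_f I_h] contains [1]; for the latter, compatibility of [f] and [h] with the
    comultiplication exhibits a lift of each [m] in [M] to an element of
    [S (x)_B M] killed by the [B]-linear map [s |-> f (- s (x) -) - (- (x) s -)],
    whose kernel is [I_f].  If [M] is faithfully flat over [B], this lift comes from
    [I_f (x)_B M], so [M = I_f M], and faithfulness gives [1 in I_f I_h]; if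
    [M] is separable, a [B]-bimodule retraction of [B -> S] replaces flatness.
    The case of [M^*] reduces to that of [M] over the opposite rings, and for this
    symmetry [M^*] is abstracted to an arbitrary dual module ([comatrix] below). *)

(** With a dual basis e_k, x_k, the lift of m is sum_k e_k (x) h (x_k (x) m), read in S (x)_B M = M
    (x)_A Sigma. Multiplication S (x)_B M -> M sends it to sum_k e_k eps (h (x_k (x) m)) = m, since
    h preserves the counit; it is killed because Delta h = (h (x) h) Delta and f h = 1. In the
    separable case the retraction contracts f (phi (x) -) against a vector of M, which gives an
    element of I_f outright, without any kernel. The equality M = I_f M does not survive the passage
    to opposite rings, where it becomes a statement about M^* only. The relation 1 in I_f I_h does
    survive, because that passage exchanges I_f with I_h and also reverses composition. Hence only
    the equalizer and this factorization are transported, the latter in the form: every subgroup of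
    maps that contains all the products contains 1. *)

Lemma additive_map0 (U V : zmodType) (f : U -> V) : additive_map f -> f 0 = 0.
Proof. by move=> fD; apply: (addIr (f 0)); rewrite -fD !add0r. Qed.

Lemma additive_mapN (U V : zmodType) (f : U -> V) :
  additive_map f -> {morph f : x / - x}.
Proof.
move=> fD x; apply: (addIr (f x)).
by rewrite -fD !addNr additive_map0.
Qed.

Lemma additive_mapB (U V : zmodType) (f : U -> V) :
  additive_map f -> {morph f : x y / x - y}.
Proof. by move=> fD x y; rewrite fD additive_mapN. Qed.

Lemma additive_map_sum (U V : zmodType) (f : U -> V) : additive_map f ->
  forall (I : Type) (r : seq I) (P : pred I) (F : I -> U),
  f (\sum_(i <- r | P i) F i) = \sum_(i <- r | P i) f (F i).
Proof. by move=> fD I r P F; apply: (big_morph f fD (additive_map0 fD)). Qed.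

(** * Subquotients, tensor products and flatness *)

(** The group laws are asked only on [P] and only up to [E], so that one construction serves both
    for subquotients of a group and for lists under concatenation. Elements of [Q] are equivalence
    classes, as predicates. *)
Lemma setoid_quotient (U : Type) (P : U -> Prop) (E : U -> U -> Prop)
    (zero : U) (add : U -> U -> U) (opp : U -> U) :
  P zero -> (forall x y, P x -> P y -> P (add x y)) -> (forall x, P x -> P (opp x)) ->
  (forall x, P x -> E x x) ->
  (forall x y, P x -> P y -> E x y -> E y x) ->
  (forall x y z, P x -> P y -> P z -> E x y -> E y z -> E x z) ->
  (forall x x' y y', P x -> P x' -> P y -> P y' ->
     E x x' -> E y y' -> E (add x y) (add x' y')) ->
  (forall x y z, P x -> P y -> P z -> E (add x (add y z)) (add (add x y) z)) ->
  (forall x y, P x -> P y -> E (add x y) (add y x)) ->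
  (forall x, P x -> E (add zero x) x) ->
  (forall x, P x -> E (add (opp x) x) zero) ->
  exists (Q : zmodType) (pi : U -> Q),
    [/\ forall q, exists2 x, P x & pi x = q,
        forall x y, P x -> P y -> (pi x = pi y <-> E x y)
      & forall x y, P x -> P y -> pi (add x y) = pi x + pi y].
Proof.
move=> P0 PD PN Er Es Et ED EA EC E0 EN.
pose cls x : U -> Prop := fun y => P y /\ E x y.
pose T := {C : U -> Prop | exists2 x, P x & C = cls x}.
have clsE x y : P x -> P y -> cls x = cls y <-> E x y.
  move=> Px Py; split=> [|Exy].
    by move/(congr1 (fun C => C y)) => e; have [] : cls x y by rewrite e; split => //; exact: Er.
  apply/funext => z; apply/propext; split=> -[Pz Ez]; split=> //.
    exact: (Et _ _ _ _ _ _ (Es _ _ Px Py Exy) Ez).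
  exact: (Et _ _ _ _ _ _ Exy Ez).
(* Outside [P] the class of [zero] is a default value. *)
pose mk x : T := match pselect (P x) with
  | left Px => exist _ (cls x) (ex_intro2 _ _ x Px erefl)
  | right _ => exist _ (cls zero) (ex_intro2 _ _ zero P0 erefl) end.
have mkE x : P x -> sval (mk x) = cls x by rewrite /mk; case: pselect.
have Tinj (u v : T) : sval u = sval v -> u = v 
  by case: u v => [u pu] [v pv] /= uv; apply: eq_exist.
have mkP x y : P x -> P y -> mk x = mk y <-> E x y.
  move=> Px Py; rewrite -clsE // -!mkE //; split=> [->//|]; exact: Tinj.
have reprP (q : T) : {x | P x /\ mk x = q}.
  apply: cid; case: (svalP q) => x Px e; exists x; split=> //.
  by apply: Tinj; rewrite mkE.
pose rp q := sval (reprP q).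
have rpP q : P (rp q) by case: (svalP (reprP q)).
have rpK q : mk (rp q) = q by case: (svalP (reprP q)).
have Erp x : P x -> E (rp (mk x)) x by move=> Px; apply/mkP => //; rewrite rpK.
pose addT u v := mk (add (rp u) (rp v)).
pose oppT u := mk (opp (rp u)).
have addTE x y : P x -> P y -> mk (add x y) = addT (mk x) (mk y).
  move=> Px Py; apply/mkP; [exact: PD | exact: PD |].
  by apply: ED => //; apply: Es => //; exact: Erp.
have addTA : associative addT.
  move=> u v w; rewrite -(rpK u) -(rpK v) -(rpK w) -!addTE //; do ?exact: PD.
  by apply/mkP; [apply: (PD) => //; exact: PD | apply: (PD) => //; exact: PD | exact: EA].
have addTC : commutative addT.
  by move=> u v; apply/mkP; [exact: PD | exact: PD | exact: EC].
have add0T : left_id (mk zero) addT.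
  move=> u; rewrite -(rpK u) -addTE //.
  by apply/mkP => //; [exact: PD | exact: E0].
have addNT : left_inverse (mk zero) oppT addT.
  move=> u; rewrite -{2}(rpK u) -addTE //; last exact: PN.
  by apply/mkP => //; [apply: PD => //; exact: PN | exact: EN].
pose Q0 : choiceType := HB.pack T (gen_eqMixin T) (gen_choiceMixin T).
pose Q : zmodType := HB.pack T (Choice.class Q0)
  (GRing.isZmodule.Build Q0 addTA addTC add0T addNT).
exists Q, mk; split=> // q; by exists (rp q).
Qed.

Local Notation balancedT := (balanced (fun=> True) (fun=> True) +%R +%R).
Local Notation is_tensorT := (is_tensor (fun=> True) (fun=> True) +%R +%R).

(** With [P] everything this is the quotient by [D]; with [D] reduced to 0 it turns a subgroup given
    by a predicate into a [zmodType]. *)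
Lemma subquotient (W : zmodType) (P D : W -> Prop) :
  P 0 -> (forall x y, P x -> P y -> P (x - y)) ->
  D 0 -> (forall x y, D x -> D y -> D (x - y)) ->
  exists (Q : zmodType) (pi : W -> Q),
    [/\ forall q, exists2 x, P x & pi x = q,
        forall x y, P x -> P y -> (pi x = pi y <-> D (x - y))
      & forall x y, P x -> P y -> pi (x + y) = pi x + pi y].
Proof.
move=> P0 PB D0 DB.
have PN x : P x -> P (- x) by move=> Px; rewrite -sub0r; exact: PB.
have DN x : D x -> D (- x) by move=> Dx; rewrite -sub0r; exact: DB.
have DD x y : D x -> D y -> D (x + y).
  by move=> Dx Dy; rewrite -(opprK y); apply: DB => //; exact: DN.
apply: (@setoid_quotient W P (fun x y => D (x - y)) 0 +%R -%R) => //.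
- by move=> x y Px Py; rewrite -(opprK y); apply: PB => //; exact: PN.
- by move=> x _; rewrite subrr.
- by move=> x y _ _ /DN; rewrite opprB.
- by move=> x y z _ _ _ Dxy Dyz; rewrite -(subrK y x) -addrA; exact: DD.
- by move=> x x' y y' _ _ _ _ Dx Dy; rewrite opprD addrACA; exact: DD.
- by move=> x y z _ _ _; rewrite addrA subrr.
- by move=> x y _ _; rewrite [y + x]addrC subrr.
- by move=> x _; rewrite add0r subrr.
- by move=> x _; rewrite addNr subr0.
Qed.

(** The module laws are asked only on [P]: in [ff_gen] the ambient [W] consists of all maps of two
    variables, and there [act] is additive in the scalar only on maps additive in the second
    variable. *)
Lemma subquotient_rmod (R : pzRingType) (W : zmodType) (act : W -> R -> W)
    (P D : W -> Prop) :
  P 0 -> (forall x y, P x -> P y -> P (x - y)) -> (forall x r, P x -> P (act x r)) ->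
  D 0 -> (forall x y, D x -> D y -> D (x - y)) ->
  (forall x r, P x -> D x -> D (act x r)) ->
  (forall x y r, P x -> P y -> act (x + y) r = act x r + act y r) ->
  (forall x r s, P x -> act x (r + s) = act x r + act x s) ->
  (forall x r s, P x -> act x (r * s) = act (act x r) s) ->
  (forall x, P x -> act x 1 = x) ->
  exists (Q : zmodType) (pi : W -> Q) (actQ : Q -> R -> Q),
    [/\ is_rmod actQ,
        forall q, exists2 x, P x & pi x = q,
        forall x y, P x -> P y -> (pi x = pi y <-> D (x - y)),
        forall x y, P x -> P y -> pi (x + y) = pi x + pi y
      & forall x r, P x -> pi (act x r) = actQ (pi x) r].
Proof.
move=> P0 PB Pact D0 DB Dact actDl actDr actM act1.
have [Q [pi [pi_surj piE piD]]] := subquotient P0 PB D0 DB.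
have actB x y r : P x -> P y -> act (x - y) r = act x r - act y r.
  move=> Px Py; apply: (addIr (act y r)); rewrite subrK -actDl ?subrK //; exact: PB.
pose rp q := s2val (cid2 (pi_surj q)).
have rpP q : P (rp q) by exact: (s2valP (cid2 (pi_surj q))).
have rpK q : pi (rp q) = q by exact: (s2valP' (cid2 (pi_surj q))).
pose actQ q r := pi (act (rp q) r).
have actQE x r : P x -> pi (act x r) = actQ (pi x) r.
  move=> Px; apply/piE; do ?exact: Pact; rewrite -actB //.
  by apply: Dact; [exact: PB | apply/piE; rewrite ?rpK].
have PN x : P x -> P (- x) by move=> Px; rewrite -sub0r; exact: PB.
have PD x y : P x -> P y -> P (x + y).
  by move=> Px Py; rewrite -(opprK y); apply: PB => //; exact: PN.
exists Q, pi, actQ; split=> //; split=> [r x y|r s x|r s x|x].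
- rewrite -(rpK x) -(rpK y) -piD // -!actQE ?actDl ?piD //; do ?exact: Pact.
  exact: PD.
- by rewrite -(rpK x) -!actQE // actDr // piD //; exact: Pact.
- by rewrite -(rpK x) -!actQE ?actM //; exact: Pact.
- by rewrite -{1}(rpK x) -actQE // act1.
Qed.

(* Formal sums of pairs, modulo equality of their values under all balanced maps. *)
Lemma tensor_exists (R : pzRingType) (N Y : zmodType) (actN : N -> R -> N)
    (actY : R -> Y -> Y) :
  exists (T : zmodType) (t : N -> Y -> T), is_tensorT actN actY t.
Proof.
pose E (w w' : seq (N * Y)) := forall (Z : zmodType) (beta : N -> Y -> Z),
  balancedT actN actY beta ->
  \sum_(p <- w) beta p.1 p.2 = \sum_(p <- w') beta p.1 p.2.
have [] := @setoid_quotient (seq (N * Y)) (fun=> True) E [::] cat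
  (map (fun p => (- p.1, p.2))) => //.
- by move=> w w' _ _ ww' Z beta b; rewrite (ww' Z beta b).
- by move=> u v w _ _ _ uv vw Z beta b; rewrite (uv Z beta b) (vw Z beta b).
- by move=> u u' v v' _ _ _ _ uu' vv' Z beta b; rewrite !big_cat (uu' Z beta b) (vv' Z beta b).
- by move=> u v w _ _ _ Z beta b; rewrite catA.
- by move=> u v _ _ Z beta b; rewrite !big_cat /= addrC.
- move=> w _ Z beta b; rewrite big_cat big_map big_nil /= -big_split big1 //= => p _.
  have [bDl _ _] := b; rewrite -bDl // addNr.
  by apply: (@additive_map0 N Z (beta^~ p.2)) => x y; exact: bDl.
move=> T [pi [pi_surj piE piD]].
have pi1 w : pi w = \sum_(p <- w) pi [:: p].
  elim: w => [|p w IHw]; last by rewrite big_cons -IHw -piD.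
  by rewrite big_nil; apply: (addIr (pi [::])); rewrite -piD ?add0r.
pose rp q := s2val (cid2 (pi_surj q)).
have rpK q : pi (rp q) = q by exact: (s2valP' (cid2 (pi_surj q))).
exists T, (fun x y => pi [:: (x, y)]); split.
  split=> [x x' y|x y y'|x r y] _ _ => [_|_|]; rewrite -?piD //.
  - by apply/piE => // Z beta [bDl _ _]; rewrite big_cat !big_seq1; exact: bDl.
  - by apply/piE => // Z beta [_ bDr _]; rewrite big_cat !big_seq1; exact: bDr.
  - by apply/piE => // Z beta [_ _ bA]; rewrite !big_seq1; exact: bA.
move=> Z beta b.
pose h q := \sum_(p <- rp q) beta p.1 p.2.
have hE w : h (pi w) = \sum_(p <- w) beta p.1 p.2.
  by have /piE : pi (rp (pi w)) = pi w by []; exact.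
exists h; split=> [p q|x y _ _|h' h'D h'E].
- by rewrite -(rpK p) -(rpK q) -piD // !hE big_cat.
- by rewrite hE big_seq1.
- apply/funext => q; rewrite -(rpK q) hE pi1 additive_map_sum //.
  by apply: eq_bigr => -[x y] _; rewrite h'E.
Qed.

(** * Kernels and membership under faithful flatness *)

Section FaithfullyFlat.
Variables (R : pzRingType) (Y : zmodType) (lY : R -> Y -> Y).
Hypothesis Yff : ff_left (fun=> True) +%R lY.

(** Since N / ker delta embeds in [K], flatness makes (N / ker delta) (x) Y -> K (x) Y injective, so
    [w] already vanishes in (N / ker delta) (x) Y; right exactness then brings it back to ker delta.
    Elements of tensor products are lists of pairs, compared under all balanced maps. *)
Lemma flat_kernel (N K : zmodType) (rN : N -> R -> N) (rK : K -> R -> K)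
    (delta : N -> K) (w : seq (N * Y)) :
  is_rmod rN -> is_rmod rK -> additive_map delta ->
  (forall x b, delta (rN x b) = rK (delta x) b) ->
  (forall (Z : zmodType) (beta : K -> Y -> Z), balancedT rK lY beta ->
     \sum_(p <- w) beta (delta p.1) p.2 = 0) ->
  exists2 w' : seq (N * Y), forall p, p \in w' -> delta p.1 = 0
    & forall (Z : zmodType) (beta : N -> Y -> Z), balancedT rN lY beta ->
      \sum_(p <- w) beta p.1 p.2 = \sum_(p <- w') beta p.1 p.2.
Proof.
move=> Nmod Kmod deltaD deltaA w0.
have [NDl NDr NM N1] := Nmod; have [KDl _ _ _] := Kmod.
have rK0 r : rK 0 r = 0 by apply: (@additive_map0 K K (rK^~ r)) => x y; exact: KDl.
have [] // := @subquotient_rmod R N rN (fun=> True) (fun x => delta x = 0).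
- exact: additive_map0.
- by move=> x y x0 y0; rewrite additive_mapB // x0 y0 subrr.
- by move=> x r _ x0; rewrite deltaA x0 rK0.
move=> Q [pi [rQ [Qmod pi_surj piE piD piA]]].
pose rp q := s2val (cid2 (pi_surj q)).
have rpK q : pi (rp q) = q by exact: (s2valP' (cid2 (pi_surj q))).
pose g q := delta (rp q).
have gE x : g (pi x) = delta x.
  by rewrite /g; apply/subr0_eq; rewrite -additive_mapB //; apply/piE; rewrite ?rpK.
have gD : additive_map g.
  by move=> p q; rewrite -(rpK p) -(rpK q) -piD // !gE.
have gA q b : g (rQ q b) = rK (g q) b by rewrite -(rpK q) -piA // !gE.
have gI : injective g.
  move=> p q; rewrite -(rpK p) -(rpK q) !gE => pq.
  by apply/piE => //; rewrite additive_mapB // pq subrr.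
have [T1 [t1 t1T]] := tensor_exists rQ lY.
have [T2 [t2 t2T]] := tensor_exists rK lY.
have [TN [tN tNT]] := tensor_exists rN lY.
have [hm [hmD hmE _]] : exists h : T1 -> T2,
    [/\ additive_map h, forall x y, True -> True -> h (t1 x y) = t2 (g x) y
      & forall h', additive_map h' ->
          (forall x y, True -> True -> h' (t1 x y) = t2 (g x) y) -> h' = h].
  apply: (t1T.2 T2 (fun q => t2 (g q))); have [tDl tDr tA] := t2T.1.
  by split=> [x x' y|x y y'|x r y] _ _ => [_|_|]; rewrite ?gD ?gA ?tDl ?tDr ?tA.
have hmI : injective hm.
  by apply: (Yff.1 _ _ _ _ Qmod Kmod _ gD gA gI _ _ _ _ t1T t2T _ hmD) => x y _; exact: hmE.
have w1 : \sum_(p <- w) t1 (pi p.1) p.2 = 0.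
  apply: hmI; rewrite (additive_map_sum hmD) (additive_map0 hmD).
  by rewrite -[RHS](w0 _ _ t2T.1); apply: eq_bigr => p _; rewrite hmE // gE.
(* Right exactness: modulo the image [D] of ker delta (x) Y, the class of n (x) y depends only on
   the class of n in [Q]. The projection thus factors through [T1], where [w] is zero. *)
pose D t := exists2 w' : seq (N * Y), forall p, p \in w' -> delta p.1 = 0
                                    & t = \sum_(p <- w') tN p.1 p.2.
have [tNl tNr tNA] := tNT.1.
have tNB x x' y : tN (x - x') y = tN x y - tN x' y.
  by apply: (@additive_mapB _ _ (tN^~ y)) => u v; exact: tNl.
have [] // := @subquotient TN (fun=> True) D.
- by exists [::]; rewrite ?big_nil.
- move=> _ _ [u u0 ->] [v v0 ->]; exists (u ++ [seq (- p.1, p.2) | p <- v]).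
    move=> p; rewrite mem_cat => /orP[/u0//|/mapP[p' /v0 p'0 ->] /=].
    by rewrite additive_mapN // p'0 oppr0.
  rewrite big_cat big_map -sumrN /=; congr (_ + _); apply: eq_bigr => p _.
  by rewrite -[- p.1]sub0r tNB -[0]subr0 tNB subrr sub0r.
move=> Z [pz [_ pzE pzD]].
have pzN n n' y : pi n = pi n' -> pz (tN n y) = pz (tN n' y).
  move=> /piE-/(_ I I) nn'; apply/pzE => //.
  by exists [:: (n - n', y)] => [p|]; rewrite ?big_seq1 ?tNB // inE => /eqP ->.
pose beta q y := pz (tN (rp q) y).
have betaE n y : beta (pi n) y = pz (tN n y) by apply: pzN; rewrite rpK.
have bbeta : balancedT rQ lY beta.
  split=> [x x' y|x y y'|x r y] _ _ => [_|_|].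
  - by rewrite -(rpK x) -(rpK x') -piD // !betaE tNl // pzD.
  - by rewrite /beta tNr // pzD.
  - by rewrite -(rpK x) -piA // !betaE tNA.
have [h [hD hE _]] := t1T.2 Z beta bbeta.
have pz0 : pz 0 = 0 by apply: additive_map0 => x y; exact: pzD.
have : pz (\sum_(p <- w) tN p.1 p.2) = pz 0.
  rewrite pz0 additive_map_sum; last by move=> x y; exact: pzD.
  rewrite -[RHS](additive_map0 hD) -[in RHS]w1 (additive_map_sum hD).
  by apply: eq_bigr => p _; rewrite hE // betaE.
move/pzE => /(_ I I); rewrite subr0 => -[w' w'0 ww']; exists w' => // Z' b bb.
have [h' [h'D h'E _]] := tNT.2 Z' b bb.
have sumE v : \sum_(p <- v) b p.1 p.2 = h' (\sum_(p <- v) tN p.1 p.2).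
  by rewrite additive_map_sum //; apply: eq_bigr => p _; rewrite h'E.
by rewrite !sumE ww'.
Qed.

(** The hypothesis says that v (x) y = 0 in (N / D) (x) Y for all y. The cyclic submodule of N / D
    generated by the class of [v] is C = R / {b | v b in D}; by flatness C (x) Y embeds in (N / D)
    (x) Y with zero image, so C (x) Y = 0, and faithfulness gives C = 0, that is, v 1 in D. *)
Lemma ff_left_mem (N : zmodType) (rN : N -> R -> N) (D : N -> Prop) (v : N) :
  is_rmod rN -> D 0 -> (forall x y, D x -> D y -> D (x - y)) ->
  (forall x b, D x -> D (rN x b)) ->
  (forall (Z : zmodType) (beta : N -> Y -> Z), balancedT rN lY beta ->
     (forall d y, D d -> beta d y = 0) -> forall y, beta v y = 0) ->
  D v.
Proof.
move=> Nmod D0 DB DA v0; have [NDl NDr NM N1] := Nmod.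
have [] // := @subquotient_rmod R N rN (fun=> True) D; first by auto.
move=> Q [pi [rQ [Qmod _ piE piD piA]]].
have NB x y r : rN (x - y) r = rN x r - rN y r.
  by apply: (@additive_mapB _ _ (rN^~ r)) => a b; exact: NDl.
have vB b c : rN v (b - c) = rN v b - rN v c.
  by apply: (@additive_mapB _ _ (rN v)) => x y; exact: NDr.
have [] // := @subquotient_rmod R R *%R (fun=> True) (fun b => D (rN v b)).
- by rewrite -(subrr 0) vB subrr.
- by move=> b c Db Dc; rewrite vB; exact: DB.
- by move=> b r _ Db; rewrite NM; exact: DA.
- by move=> x y r _ _; rewrite mulrDl.
- by move=> x r s _; rewrite mulrDr.
- by move=> x r s _; rewrite mulrA.
- by move=> x _; rewrite mulr1.
move=> C [pc [rC [Cmod pc_surj pcE pcD pcA]]].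
pose rp q := s2val (cid2 (pc_surj q)).
have rpK q : pc (rp q) = q by exact: (s2valP' (cid2 (pc_surj q))).
pose g q := pi (rN v (rp q)).
have gE b : g (pc b) = pi (rN v b).
  by apply/piE => //; rewrite -vB; apply/pcE; rewrite ?rpK.
have gD : additive_map g.
  by move=> p q; rewrite -(rpK p) -(rpK q) -pcD // !gE NDr piD.
have gA q b : g (rC q b) = rQ (g q) b.
  by rewrite -(rpK q) -pcA // !gE NM piA.
have gI : injective g.
  move=> p q; rewrite -(rpK p) -(rpK q) !gE => /piE -/(_ I I) pq.
  by apply/pcE => //; rewrite vB.
have [T1 [t1 t1T]] := tensor_exists rC lY.
have [T2 [t2 t2T]] := tensor_exists rQ lY.
have [t2l t2r t2A] := t2T.1.
have [hm [hmD hmE _]] : exists h : T1 -> T2,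
    [/\ additive_map h, forall x y, True -> True -> h (t1 x y) = t2 (g x) y
      & forall h', additive_map h' ->
          (forall x y, True -> True -> h' (t1 x y) = t2 (g x) y) -> h' = h].
  apply: (t1T.2 T2 (fun q => t2 (g q))).
  by split=> [x x' y|x y y'|x r y] _ _ => [_|_|]; rewrite ?gD ?gA ?t2l ?t2r ?t2A.
have hmI : injective hm.
  by apply: (Yff.1 _ _ _ _ Cmod Qmod _ gD gA gI _ _ _ _ t1T t2T _ hmD) => x y _; exact: hmE.
have bal2 : balancedT rN lY (fun x y => t2 (pi x) y).
  by split=> [x x' y|x y y'|x r y] _ _ => [_|_|]; rewrite ?piD ?piA ?t2l ?t2r ?t2A.
have pi0 : pi 0 = 0 by apply: additive_map0 => x y; exact: piD.
have t20 y : t2 0 y = 0 by apply: (@additive_map0 _ _ (t2^~ y)) => a b; exact: t2l.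
have tv y : t2 (pi v) y = 0.
  apply: (v0 _ _ bal2) => d z Dd.
  suff -> : pi d = 0 by rewrite t20.
  by rewrite -pi0; apply/piE; rewrite ?subr0.
have hm0 x y : hm (t1 x y) = 0.
  by rewrite hmE // -(rpK x) gE piA // t2A.
have T10 z : z = 0 :> T1.
  apply: hmI; rewrite (additive_map0 hmD).
  have [h [_ _ huniq]] := t1T.2 T2 (fun _ _ => 0) ltac:(by split=> *; rewrite ?addr0).
  rewrite (huniq hm) // -(huniq (fun=> 0)) // => ? ?; by rewrite addr0.
have pc0 : pc 0 = 0 by apply: additive_map0 => x y; exact: pcD.
have : pc 1 = pc 0 by rewrite pc0; exact: (Yff.2 _ _ Cmod _ _ t1T T10).
by move=> /pcE -/(_ I I); rewrite subr0 N1.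
Qed.
End FaithfullyFlat.

(** * Dual pairs and their comatrix coring *)

Definition subgroup (V : zmodType) (D : V -> Prop) : Prop :=
  D 0 /\ forall x y, D x -> D y -> D (x - y).

Section Subgroup.
Variables (V : zmodType) (D : V -> Prop).
Hypothesis subD : subgroup D.

Lemma subgroupN x : D x -> D (- x).
Proof. by move=> Dx; rewrite -sub0r; apply: subD.2 => //; exact: subD.1. Qed.

Lemma subgroupD x y : D x -> D y -> D (x + y).
Proof. by move=> Dx Dy; rewrite -(opprK y); apply: subD.2 => //; exact: subgroupN. Qed.

Lemma subgroup_sum (I : eqType) (r : seq I) (F : I -> V) :
  (forall i, i \in r -> D (F i)) -> D (\sum_(i <- r) F i).
Proof.
move=> DF; rewrite big_seq; elim/big_ind: _ => //; first exact: subD.1.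
exact: subgroupD.
Qed.
End Subgroup.

(** Generation by pure tensors is not a clause of [is_tensor]; it follows from uniqueness, applied
    to the projection onto T / D and the zero map. *)
Lemma tensor_ind (R : pzRingType) (X Y : Type) (PX : X -> Prop) (PY : Y -> Prop)
    addX addY ractX lactY (T : zmodType) (tau : X -> Y -> T) (D : T -> Prop) :
  @is_tensor R X Y PX PY addX addY ractX lactY T tau -> subgroup D ->
  (forall x y, PX x -> PY y -> D (tau x y)) -> forall t, D t.
Proof.
move=> [tau_bal tauU] [D0 DB] Dtau t.
have [] // := @subquotient T (fun=> True) D.
move=> Q [pi [_ piE piD]].
have piA : additive_map pi by move=> x y; exact: piD.
have pi0 := additive_map0 piA.
have [|h [_ _ hU]] := tauU Q (fun _ _ => 0); first by split=> *; rewrite ?addr0.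
suff : pi t = pi 0 by move/piE => /(_ I I); rewrite subr0.
rewrite pi0 (hU pi) -?(hU (fun=> 0)) // => [x y|x y Px Py]; first by rewrite addr0.
by rewrite -pi0; apply/piE; rewrite ?subr0 //; exact: Dtau.
Qed.

Lemma tensor_ext (R : pzRingType) (X Y : Type) (PX : X -> Prop) (PY : Y -> Prop)
    addX addY ractX lactY (T Z : zmodType) (tau : X -> Y -> T) (f g : T -> Z) :
  @is_tensor R X Y PX PY addX addY ractX lactY T tau ->
  additive_map f -> additive_map g ->
  (forall x y, PX x -> PY y -> f (tau x y) = g (tau x y)) -> forall t, f t = g t.
Proof.
move=> tauT fD gD fg; apply: (tensor_ind (D := fun t => f t = g t) tauT) => //.
split=> [|x y fx fy]; first by rewrite !additive_map0.
by rewrite !additive_mapB // fx fy.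
Qed.

(* [cY] is [M] and [cX] is [M^*]; the axioms are invariant under exchanging the two
   and passing to the opposite rings. *)
Record comatrix := Comatrix {
  cA : pzRingType;
  cB : pzRingType;
  cX : zmodType;
  cY : zmodType;
  clX : cA -> cX -> cX;
  crX : cX -> cB -> cX;
  clY : cB -> cY -> cY;
  crY : cY -> cA -> cY;
  cX_bimod : is_bimod clX crX;
  cY_bimod : is_bimod clY crY;
  cev : cX -> cY -> cA;
  cevDl : forall y, additive_map (cev^~ y);
  cevDr : forall x, additive_map (cev x);
  cevAl : forall a x y, cev (clX a x) y = a * cev x y;
  cevAr : forall x y a, cev x (crY y a) = cev x y * a;
  cevB : forall x b y, cev (crX x b) y = cev x (clY b y);
  cn : nat;
  ce : 'I_cn -> cY;
  cx : 'I_cn -> cX;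
  cdbY : forall y, \sum_(k < cn) crY (ce k) (cev (cx k) y) = y;
  cdbX : forall x, \sum_(k < cn) clX (cev x (ce k)) (cx k) = x;
  cT : zmodType;
  ctau : cX -> cY -> cT;
  ctauP : is_tensorT crX clY ctau;
  clT : cA -> cT -> cT;
  crT : cT -> cA -> cT;
  clTD : forall a, additive_map (clT a);
  crTD : forall a, additive_map (crT^~ a);
  clTE : forall a x y, clT a (ctau x y) = ctau (clX a x) y;
  crTE : forall a x y, crT (ctau x y) a = ctau x (crY y a);
  cT2 : zmodType;
  ctau2 : cT -> cT -> cT2;
  ctau2P : is_tensorT crT clT ctau2;
  cDelta : cT -> cT2;
  cDeltaD : additive_map cDelta;
  cDeltaE : forall x y, cDelta (ctau x y) =
    \sum_(k < cn) ctau2 (ctau x (ce k)) (ctau (cx k) y);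
  ceps : cT -> cA;
  cepsD : additive_map ceps;
  cepsE : forall x y, ceps (ctau x y) = cev x y }.

(** * Passage to opposite rings *)

Lemma is_lmod_conv (R : pzRingType) (N : zmodType) (act : N -> R -> N) :
  is_rmod act -> @is_lmod R^c N (fun r x => act x r).
Proof. by case=> aDl aDr aM a1; split=> // r s x; exact: aM. Qed.

Lemma is_rmod_conv (R : pzRingType) (N : zmodType) (act : R -> N -> N) :
  is_lmod act -> @is_rmod R^c N (fun x r => act r x).
Proof. by case=> aDl aDr aM a1; split=> // r s x; exact: aM. Qed.

Lemma balanced_conv (R : pzRingType) (X Y : Type) (PX : X -> Prop) (PY : Y -> Prop)
    addX addY ractX lactY (Z : zmodType) (beta : X -> Y -> Z) :
  @balanced R X Y PX PY addX addY ractX lactY Z beta ->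
  @balanced R^c Y X PY PX addY addX (fun y r => lactY r y) (fun r x => ractX x r) Z
    (fun y x => beta x y).
Proof.
case=> bDl bDr bA.
by split=> [y y' x ? ? ?|y x x' ? ? ?|y r x ? ?]; [exact: bDr|exact: bDl|rewrite bA].
Qed.

Lemma is_tensor_conv (R : pzRingType) (X Y : Type) (PX : X -> Prop) (PY : Y -> Prop)
    addX addY ractX lactY (T : zmodType) (tau : X -> Y -> T) :
  @is_tensor R X Y PX PY addX addY ractX lactY T tau ->
  @is_tensor R^c Y X PY PX addY addX (fun y r => lactY r y) (fun r x => ractX x r) T
    (fun y x => tau x y).
Proof.
case=> tau_bal tauU; split; first exact: balanced_conv.
move=> Z beta beta_bal.
have [h [hD hE hU]] := tauU Z (fun x y => beta y x) (balanced_conv beta_bal).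
exists h; split=> // [y x Py Px|h' h'D h'E]; first exact: hE.
by apply: hU => // x y Px Py; exact: h'E.
Qed.

Section Conv.
Variable C : comatrix.

(** The formula for [cDelta] is its own mirror image: the two halves of the dual basis are
    exchanged, and so are the two factors of Sigma (x) Sigma. The construction is transparent
    because its projections are later used up to conversion. *)
Definition comatrix_conv : comatrix.
Proof.
refine (@Comatrix (cA C)^c (cB C)^c (cY C) (cX C)
  (fun a y => crY y a) (fun y b => clY b y) (fun b x => crX x b) (fun x a => clX a x)
  _ _ (fun y x => cev x y) _ _ _ _ _ (cn C) (@cx C) (@ce C) _ _
  (cT C) (fun y x => ctau x y) (is_tensor_conv (ctauP C))
  (fun a t => crT t a) (fun t a => clT a t) _ _ _ _
  (cT2 C) (fun t u => ctau2 u t) (is_tensor_conv (ctau2P C))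
  (@cDelta C) (@cDeltaD C) _ (@ceps C) (@cepsD C) _).
- have [lYm rYm lrY] := cY_bimod C.
  by split; [exact: is_lmod_conv | exact: is_rmod_conv | move=> *; rewrite lrY].
- have [lXm rXm lrX] := cX_bimod C.
  by split; [exact: is_lmod_conv | exact: is_rmod_conv | move=> *; rewrite lrX].
- exact: cevDr.
- exact: cevDl.
- by move=> *; exact: cevAr.
- by move=> *; exact: cevAl.
- by move=> *; rewrite cevB.
- exact: cdbX.
- exact: cdbY.
- exact: crTD.
- exact: clTD.
- by move=> *; exact: crTE.
- by move=> *; exact: clTE.
- by move=> *; exact: cDeltaE.
- by move=> *; exact: cepsE.
Defined.
End Conv.

(** * Translators, coring endomorphisms and descent *)

Section Comatrix.
Variable C : comatrix.
Local Notation A := (cA C).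
Local Notation B := (cB C).
Local Notation X := (cX C).
Local Notation Y := (cY C).
Local Notation T := (cT C).
Local Notation lX := (@clX C).
Local Notation rX := (@crX C).
Local Notation lY := (@clY C).
Local Notation rY := (@crY C).
Local Notation ev := (@cev C).
Local Notation tau := (@ctau C).
Local Notation tau2 := (@ctau2 C).
Local Notation lT := (@clT C).
Local Notation rT := (@crT C).
Local Notation e := (@ce C).
Local Notation x_ := (@cx C).
Local Notation n := (cn C).

Lemma lXDr a : additive_map (lX a).
Proof. by case: (cX_bimod C) => -[D _ _ _] _ _ r s; exact: D. Qed.
Lemma lXDl x : additive_map (lX^~ x).
Proof. by case: (cX_bimod C) => -[_ D _ _] _ _ r s; exact: D. Qed.
Lemma rXDl b : additive_map (rX^~ b).
Proof. by case: (cX_bimod C) => _ [D _ _ _] _ r s; exact: D. Qed.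
Lemma rYDl a : additive_map (rY^~ a).
Proof. by case: (cY_bimod C) => _ [D _ _ _] _ r s; exact: D. Qed.
Lemma rYDr y : additive_map (rY y).
Proof. by case: (cY_bimod C) => _ [_ D _ _] _ r s; exact: D. Qed.
Lemma lYDl y : additive_map (lY^~ y).
Proof. by case: (cY_bimod C) => -[_ D _ _] _ _ r s; exact: D. Qed.
Lemma tauDl y : additive_map (tau^~ y).
Proof. by move=> x x'; have [tDl _ _] := (ctauP C).1; exact: tDl. Qed.
Lemma tauDr x : additive_map (tau x).
Proof. by move=> y y'; have [_ tDr _] := (ctauP C).1; exact: tDr. Qed.
Lemma tau2Dl y : additive_map (tau2^~ y).
Proof. by move=> x x'; have [tDl _ _] := (ctau2P C).1; exact: tDl. Qed.
Lemma tau2Dr x : additive_map (tau2 x).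
Proof. by move=> y y'; have [_ tDr _] := (ctau2P C).1; exact: tDr. Qed.
Lemma tauB x b y : tau (rX x b) y = tau x (lY b y).
Proof. by have [_ _ tA] := (ctauP C).1; exact: tA. Qed.
Lemma tau2A t a u : tau2 (rT t a) u = tau2 t (lT a u).
Proof. by have [_ _ tA] := (ctau2P C).1; exact: tA. Qed.

Lemma tau_expand t : exists w : seq (X * Y), t = \sum_(p <- w) tau p.1 p.2.
Proof.
apply: (tensor_ind (D := fun t => exists w : seq (X * Y), t = \sum_(p <- w) tau p.1 p.2)
  (ctauP C)) => [|x y _ _]; last by exists [:: (x, y)]; rewrite big_seq1.
split=> [|_ _ [u ->] [v ->]]; first by exists [::]; rewrite big_nil.
exists (u ++ [seq (- p.1, p.2) | p <- v]); rewrite big_cat big_map -sumrN /=.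
by congr (_ + _); apply: eq_bigr => p _; rewrite (additive_mapN (tauDl _)).
Qed.

Lemma lTM a b t : lT (a * b) t = lT a (lT b t).
Proof.
have [[_ _ lXM _] _ _] := cX_bimod C.
move: t; apply: (tensor_ext (ctauP C)); first exact: clTD.
  by move=> u v; rewrite !clTD.
by move=> x y _ _; rewrite !clTE lXM.
Qed.

Lemma lTDl t : additive_map (lT^~ t).
Proof.
move=> a b; move: t.
apply: (tensor_ext (ctauP C)) => [|u v|x y _ _]; first exact: clTD.
  by rewrite !clTD addrACA.
by rewrite !clTE lXDl tauDl.
Qed.

Lemma rTDr t : additive_map (rT t).
Proof.
move=> a b; move: t.
apply: (tensor_ext (ctauP C)) => [|u v|x y _ _]; first exact: crTD.
  by rewrite !crTD addrACA.
by rewrite !crTE rYDr tauDr.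
Qed.

Lemma rTM t a b : rT t (a * b) = rT (rT t a) b.
Proof.
have [_ [_ _ rYM _] _] := cY_bimod C.
move: t; apply: (tensor_ext (ctauP C)) => [|u v|x y _ _]; first exact: crTD.
  by rewrite !crTD.
by rewrite !crTE rYM.
Qed.

(* Maps out of [Sigma (x)_A X (x)_B Y = Sigma (x)_A Sigma]. *)
Lemma tensor2_lift (Z : zmodType) (gam : T -> X -> Y -> Z) :
  (forall x y, additive_map (fun t => gam t x y)) ->
  (forall t y, additive_map (fun x => gam t x y)) ->
  (forall t x, additive_map (gam t x)) ->
  (forall t x b y, gam t (rX x b) y = gam t x (lY b y)) ->
  (forall t a x y, gam (rT t a) x y = gam t (lX a x) y) ->
  exists2 R : cT2 C -> Z, additive_map R &
    forall t x y, R (tau2 t (tau x y)) = gam t x y.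
Proof.
move=> gD1 gD2 gD3 gB gA.
have /choice[S SP] t : exists S : T -> Z,
    additive_map S /\ forall x y, S (tau x y) = gam t x y.
  have [|S [SD SE _]] := (ctauP C).2 Z (gam t); last by exists S; split=> // x y; exact: SE.
  by split=> *; rewrite ?gD2 ?gD3 ?gB.
have SD t := (SP t).1; have SE t := (SP t).2.
have [|R [RD RE _]] := (ctau2P C).2 Z S.
  split=> [t t' u|t u u'|t a u] _ _ => [_|_|]; last 2 first.
  - exact: SD.
  - move: u; apply: (tensor_ext (ctauP C)) => // [u v|x y _ _]; first by rewrite clTD SD.
    by rewrite clTE !SE gA.
  - move: u; apply: (tensor_ext (ctauP C)) => // [u v|x y _ _]; first by rewrite !SD addrACA.
    by rewrite !SE gD1.
by exists R => // t x y; rewrite RE // SE.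
Qed.

Definition adjoint (p : X -> X) (q : Y -> Y) : Prop := forall x y, ev (p x) y = ev x (q y).

Lemma ev_injr y y' : (forall x, ev x y = ev x y') -> y = y'.
Proof. by move=> yy'; rewrite -(cdbY y) -(cdbY y'); apply: eq_bigr => k _; rewrite yy'. Qed.

(* With [q] an endomorphism [s] of [M] and [p] its transpose, this is the condition
   [s g = 1 (x) s] in [S (x)_B S], where [g] is the grouplike element of [f]. *)
Definition translator (f : T -> T) (p : X -> X) (q : Y -> Y) : Prop :=
  adjoint p q /\ forall x y, f (tau (p x) y) = tau x (q y).

(** Whereas [coring_aut] quantifies over all candidates for f (x) f, here one is supplied, ready for
    use. *)
Record coring_endo (f : T -> T) : Prop := CoringEndo {
  coring_endoD : additive_map f;
  coring_endoAl : forall a t, f (lT a t) = lT a (f t);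
  coring_endoAr : forall t a, f (rT t a) = rT (f t) a;
  coring_endo_eps : forall t, ceps (f t) = ceps t;
  coring_endo_Delta : exists g, [/\ additive_map g,
    forall t u, g (tau2 t u) = tau2 (f t) (f u)
    & forall t, cDelta (f t) = g (cDelta t)] }.

Lemma coring_endo_inv f h : coring_endo f -> cancel f h -> cancel h f -> coring_endo h.
Proof.
case=> fD fAl fAr feps [g [gD gE gDelta]] fK hK.
have hD : additive_map h by move=> t u; rewrite -{1}(hK t) -{1}(hK u) -fD fK.
have hAl a t : h (lT a t) = lT a (h t) by rewrite -{1}(hK t) -fAl fK.
have hAr t a : h (rT t a) = rT (h t) a by rewrite -{1}(hK t) -fAr fK.
have [|g' [g'D g'E _]] := (ctau2P C).2 _ (fun t u => tau2 (h t) (h u)).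
  by split=> *; rewrite ?hD ?hAl ?hAr ?tau2Dl ?tau2Dr ?tau2A.
split=> // [t|]; first by rewrite -[t in RHS]hK feps.
exists g'; split=> // [t u|t]; first exact: g'E.
rewrite -{2}(hK t) gDelta.
apply/esym; move: (cDelta (h t)); apply: (tensor_ext (ctau2P C)) => // [u v|u v _ _].
  by rewrite gD g'D.
by rewrite gE g'E // !fK.
Qed.

(* The three facts about [B -> S] which make [I_f] and [I_(f^-1)] mutually inverse;
   [descent_equalizer] says that [B] is the equalizer of [S => S (x)_B S]. *)
Record descent : Prop := Descent {
  descent_equalizer : forall p q, translator id p q -> exists b, q =1 lY b;
  descent_gen : forall f h, coring_endo f -> coring_endo h -> cancel f h -> cancel h f ->
    forall G : Y -> Prop, subgroup G ->
    (forall p q y, translator f p q -> G (q y)) -> forall y, G y;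
  descent_ideal : forall D : B -> Prop, subgroup D ->
    (forall b c, D b -> D (b * c)) ->
    (forall G : Y -> Prop, subgroup G ->
       (forall b y, D b -> G (lY b y)) -> forall y, G y) -> D 1 }.

(* [v] stands for the endomorphism [sum_k e_k (x) v_k] under [S = M (x)_A M^*]. *)
Definition end_left (v : {ffun 'I_n -> X}) (y : Y) : Y := \sum_(k < n) rY (e k) (ev (v k) y).
Definition end_right (v : {ffun 'I_n -> X}) (x : X) : X := \sum_(k < n) lX (ev x (e k)) (v k).
Definition end_act (v : {ffun 'I_n -> X}) (b : B) : {ffun 'I_n -> X} := [ffun k => rX (v k) b].
Definition single (k : 'I_n) (x : X) : {ffun 'I_n -> X} := [ffun j => if j == k then x else 0].

Lemma ev0l y : ev 0 y = 0. Proof. exact: (additive_map0 (cevDl y)). Qed.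
Lemma ev0r x : ev x 0 = 0. Proof. exact: (additive_map0 (cevDr x)). Qed.
Lemma ev_suml y (I : finType) (F : I -> X) : ev (\sum_i F i) y = \sum_i ev (F i) y.
Proof. exact: (additive_map_sum (cevDl y)). Qed.
Lemma ev_sumr x (I : finType) (F : I -> Y) : ev x (\sum_i F i) = \sum_i ev x (F i).
Proof. exact: (additive_map_sum (cevDr x)). Qed.
Lemma ctau_suml y (I : finType) (F : I -> X) : tau (\sum_i F i) y = \sum_i tau (F i) y.
Proof. exact: (additive_map_sum (tauDl y)). Qed.
Lemma ctau_sumr x (I : finType) (F : I -> Y) : tau x (\sum_i F i) = \sum_i tau x (F i).
Proof. exact: (additive_map_sum (tauDr x)). Qed.

Lemma adjoint_end v : adjoint (end_right v) (end_left v).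
Proof.
move=> x y; rewrite /end_right /end_left ev_suml ev_sumr.
by apply: eq_bigr => k _; rewrite cevAl cevAr.
Qed.

Lemma end_leftDl y : additive_map (end_left^~ y).
Proof.
by move=> v w; rewrite /end_left -big_split; apply: eq_bigr => k _; rewrite ffunE cevDl rYDr.
Qed.

Lemma end_leftDr v : additive_map (end_left v).
Proof.
by move=> y z; rewrite /end_left -big_split; apply: eq_bigr => k _; rewrite cevDr rYDr.
Qed.

Lemma end_rightDl x : additive_map (end_right^~ x).
Proof.
by move=> v w; rewrite /end_right -big_split; apply: eq_bigr => k _; rewrite ffunE lXDr.
Qed.

Lemma end_left_act v b y : end_left (end_act v b) y = end_left v (lY b y).
Proof. by apply: eq_bigr => k _; rewrite ffunE cevB. Qed.

Lemma end_right_act v b x : end_right (end_act v b) x = rX (end_right v x) b.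
Proof.
rewrite (additive_map_sum (rXDl b)); apply: eq_bigr => k _; rewrite ffunE.
by case: (cX_bimod C).
Qed.

Lemma single_sum (v : {ffun 'I_n -> X}) : \sum_k single k (v k) = v.
Proof.
apply/ffunP => j; rewrite sum_ffunE (bigD1 j) //= ffunE eqxx big1 ?addr0 // => k kj.
by rewrite ffunE eq_sym (negbTE kj).
Qed.

Lemma singleD k : additive_map (single k).
Proof. by move=> x x'; apply/ffunP => j; rewrite !ffunE; case: eqP => _; rewrite ?addr0. Qed.

Lemma single_act k x b : single k (rX x b) = end_act (single k x) b.
Proof.
apply/ffunP => j; rewrite !ffunE; case: eqP => // _.
by rewrite (additive_map0 (rXDl b)).
Qed.

Lemma end_left_single k x y : end_left (single k x) y = rY (e k) (ev x y).
Proof.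
rewrite /end_left (bigD1 k) //= ffunE eqxx big1 ?addr0 // => j jk.
by rewrite ffunE (negbTE jk) ev0l (additive_map0 (rYDr _)).
Qed.

Lemma end_right_single k x x' : end_right (single k x) x' = lX (ev x' (e k)) x.
Proof.
rewrite /end_right (bigD1 k) //= ffunE eqxx big1 ?addr0 // => j jk.
by rewrite ffunE (negbTE jk) (additive_map0 (lXDr _)).
Qed.

Lemma end_act_rmod : is_rmod end_act.
Proof.
have [_ [rDl rDr rM r1] _] := cX_bimod C.
split=> [b v w|b c v|b c v|v]; apply/ffunP => k; rewrite !ffunE //.
Qed.

Lemma end_leftK (p : X -> X) (q : Y -> Y) : adjoint p q ->
  end_left [ffun k => p (x_ k)] =1 q.
Proof.
by move=> pq y; rewrite -[RHS]cdbY; apply: eq_bigr => k _; rewrite ffunE pq.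
Qed.

(** * Descent when the module is faithfully flat *)

Section FaithfullyFlatDescent.
Hypothesis Yff : ff_left (fun=> True) +%R lY.

(** In S (x)_B M one has q (x) y = 1 (x) q y: on the k-th component this is the translator identity
    at x_k. Hence q (x) y vanishes modulo the image of [B], and [ff_left_mem] puts q in [B]. *)
Lemma ff_equalizer p q : translator id p q -> exists b, q =1 lY b.
Proof.
move=> [pq tpq]; have [[lDr lDl lM l1] _ _] := cY_bimod C.
pose v := [ffun k => p (x_ k)].
pose D (v : {ffun 'I_n -> X}) := exists b, end_left v =1 lY b.
suff [b vb] : D v by exists b => y; rewrite -(end_leftK pq).
apply: (ff_left_mem Yff end_act_rmod).
- exists 0 => y; rewrite (additive_map0 (end_leftDl y)).
  by rewrite (additive_map0 (lYDl y)).
- move=> w w' [b wb] [c wc]; exists (b - c) => y.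
  by rewrite (additive_mapB (end_leftDl y)) wb wc (additive_mapB (lYDl y)).
- by move=> w b [c wc]; exists (c * b) => y; rewrite end_left_act wc lM.
move=> Z beta [bDl bDr bA] beta0 y.
have bDl' y' : additive_map (beta^~ y') by move=> w w'; exact: bDl.
have /choice[h hP] k : exists h : T -> Z,
    additive_map h /\ forall x y, h (tau x y) = beta (single k x) y.
  have [|h [hD hE _]] := (ctauP C).2 Z (fun x y => beta (single k x) y).
    by split=> *; rewrite ?singleD ?single_act ?bDl ?bDr ?bA.
  by exists h; split=> // *; exact: hE.
rewrite -(single_sum v) (additive_map_sum (bDl' y)).
transitivity (beta [ffun k => x_ k] (q y)).
  rewrite -[in RHS](single_sum [ffun k => x_ k]) (additive_map_sum (bDl' _)).
  by apply: eq_bigr => k _; rewrite !ffunE -!(hP k).2 tpq.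
apply: beta0; exists 1 => z; rewrite l1.
by rewrite -[RHS]cdbY; apply: eq_bigr => k _; rewrite ffunE.
Qed.

(** Here (B / D) (x)_B M = M / D M = 0. *)
Lemma ff_ideal (D : B -> Prop) : subgroup D -> (forall b c, D b -> D (b * c)) ->
  (forall G : Y -> Prop, subgroup G ->
     (forall b y, D b -> G (lY b y)) -> forall y, G y) -> D 1.
Proof.
move=> [D0 DB] DM Dgen.
have Bmod : is_rmod (@GRing.mul B).
  by split=> *; rewrite ?mulrDl ?mulrDr ?mulrA ?mulr1.
apply: (ff_left_mem Yff Bmod D0 DB) => [x b|Z beta [bDl bDr bA] beta0]; first exact: DM.
have bDr' x : additive_map (beta x) by move=> y y'; exact: bDr.
apply: Dgen => [|b y Db]; last by rewrite -bA // mul1r; exact: beta0.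
split=> [|y y' y0 y'0]; first exact: (additive_map0 (bDr' 1)).
by rewrite (additive_mapB (bDr' 1)) y0 y'0 subrr.
Qed.

Lemma ff_gen f h : coring_endo f -> coring_endo h -> cancel f h -> cancel h f ->
  forall G : Y -> Prop, subgroup G ->
  (forall p q y, translator f p q -> G (q y)) -> forall y, G y.
Proof.
move=> [fD fAl fAr feps fDelta] [hD hAl hAr heps [g [gD gE gDelta]]] fK hK G subG Gtr y0.
have [[lDr lDl lM l1] _ lrY] := cY_bimod C.
(* The target [K] of the map with kernel I_f: maps to Sigma that are additive in the second
   variable, through which [B] acts on the right. *)
pose W := X -> Y -> T.
pose PW (kap : W) := forall x, additive_map (kap x).
pose actW (kap : W) b : W := fun x y => kap x (lY b y).
have [] := @subquotient_rmod B W actW PW (fun kap => kap = 0).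
- by move=> x y y'; rewrite addr0.
- move=> k k' Pk Pk' x y y'.
  change (k x (y + y') - k' x (y + y') = (k x y - k' x y) + (k x y' - k' x y')).
  by rewrite Pk Pk' opprD addrACA.
- by move=> k b Pk x y y'; rewrite /actW lDr Pk.
- by [].
- by move=> x y -> ->; rewrite subrr.
- by move=> k b _ ->.
- by [].
- by move=> k r s Pk; apply/funext => x; apply/funext => y; rewrite /actW lDl Pk.
- by move=> k r s Pk; apply/funext => x; apply/funext => y; rewrite /actW lM.
- by move=> k Pk; apply/funext => x; apply/funext => y; rewrite /actW l1.
move=> K [pi [rK [Kmod _ piE piD piA]]].
have PW0 : PW 0 by move=> x y y'; rewrite addr0.
have PWD k k' : PW k -> PW k' -> PW (k + k').
  move=> Pk Pk' x y y'.
  change (k x (y + y') + k' x (y + y') = (k x y + k' x y) + (k x y' + k' x y')).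
  by rewrite Pk Pk' addrACA.
have pi0 : pi 0 = 0 by apply: (addIr (pi 0)); rewrite -piD // !add0r.
have pi_sum (I : finType) (F : I -> W) : (forall i, PW (F i)) ->
    pi (\sum_i F i) = \sum_i pi (F i).
  move=> PF; suff [] : PW (\sum_i F i) /\ pi (\sum_i F i) = \sum_i pi (F i) by [].
  elim/big_rec2: _ => [|i q k _ [Pk <-]]; first by rewrite pi0.
  by split; [exact: PWD | rewrite piD].
have sumWE (I : finType) (F : I -> W) x y : (\sum_i F i) x y = \sum_i F i x y.
  exact: (additive_map_sum (f := fun k : W => k x y)).
pose dl (v : {ffun 'I_n -> X}) : W :=
  fun x y => f (tau (end_right v x) y) - tau x (end_left v y).
have Pdl v : PW (dl v).
  by move=> x y y'; rewrite /dl tauDr fD end_leftDr tauDr opprD addrACA.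
have dlD v w : dl (v + w) = dl v + dl w.
  apply/funext => x; apply/funext => y.
  change (dl (v + w) x y = dl v x y + dl w x y).
  by rewrite /dl end_rightDl tauDl fD end_leftDl tauDr opprD addrACA.
pose delta v := pi (dl v).
have deltaD : additive_map delta by move=> v w; rewrite /delta dlD piD.
have deltaA v b : delta (end_act v b) = rK (delta v) b.
  rewrite /delta -piA //; congr pi; apply/funext => x; apply/funext => y.
  by rewrite /dl /actW end_left_act end_right_act tauB.
have delta0 v : delta v = 0 -> translator f (end_right v) (end_left v).
  rewrite -pi0 => /piE -/(_ (Pdl v) PW0); rewrite subr0 => dl0.
  split=> [|x y]; first exact: adjoint_end.
  by apply/subr0_eq; rewrite -[LHS]/(dl v x y) dl0.
have [rp rpE] := choice (tau_expand).
(* This is sum_k e_k (x) h (x_k (x) y0), written out in S (x)_B M by means of the chosen expansions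
   [rp]. *)
pose w := [seq (single k p.1, p.2) | k <- index_enum 'I_n, p <- rp (h (tau (x_ k) y0))].
have sum_w (Z : zmodType) (F : {ffun 'I_n -> X} -> Y -> Z) :
    \sum_(p <- w) F p.1 p.2 =
    \sum_k \sum_(p <- rp (h (tau (x_ k) y0))) F (single k p.1) p.2.
  by rewrite /w big_allpairs_dep.
have [|w' w'0 ww'] := flat_kernel (w := w) Yff end_act_rmod Kmod deltaD deltaA.
  move=> Z beta [bDl bDr bA]; rewrite (sum_w Z (fun v => beta (delta v))).
  have bDl' y : additive_map (beta^~ y) by move=> k k'; exact: bDl.
  pose kap k (t : T) phi : W := fun x y => lT (ev x (e k)) (rT t (ev phi y)).
  have Pkap k t phi : PW (kap k t phi).
    by move=> x y y'; rewrite /kap cevDr rTDr clTD.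
  have kapDt k t t' phi : kap k (t + t') phi = kap k t phi + kap k t' phi.
    apply/funext => x; apply/funext => y.
    change (kap k (t + t') phi x y = kap k t phi x y + kap k t' phi x y).
    by rewrite /kap crTD clTD.
  have kapDx k t phi phi' : kap k t (phi + phi') = kap k t phi + kap k t phi'.
    apply/funext => x; apply/funext => y.
    change (kap k t (phi + phi') x y = kap k t phi x y + kap k t phi' x y).
    by rewrite /kap cevDl rTDr clTD.
  have kapB k t phi b : kap k t (rX phi b) = actW (kap k t phi) b.
    by apply/funext => x; apply/funext => y; rewrite /kap /actW cevB.
  have kapA k t a phi : kap k (rT t a) phi = kap k t (lX a phi).
    by apply/funext => x; apply/funext => y; rewrite /kap cevAl rTM.
  (* [R k] sends t (x) (phi (x) m) to beta at (x, y) |-> x(e_k) f(t) phi(y) and m. Evaluated on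
     Delta (h (x_k (x) y0)) directly, it gives the half of [delta] that involves f; evaluated
     through (h (x) h) Delta, it gives the other half once f h = 1 is used and k is summed. *)
  have /choice[R RP] k : exists R : cT2 C -> Z, additive_map R /\
      forall t x y, R (tau2 t (tau x y)) = beta (pi (kap k (f t) x)) y.
    have [||||t a x y|R RD RE] := @tensor2_lift Z (fun t x => beta (pi (kap k (f t) x))).
    - by move=> x y t t'; rewrite fD kapDt piD // bDl.
    - by move=> t y x x'; rewrite kapDx piD // bDl.
    - by move=> t x y y'; rewrite bDr.
    - by move=> t x b y; rewrite kapB piA // bA.
    - by rewrite fAr kapA.
    - by exists R.
  have RD k := (RP k).1; have RE k := (RP k).2.
  pose kap1 k phi : W := fun x y => f (tau (lX (ev x (e k)) phi) y).
  pose kap2 k phi : W := fun x y => tau x (rY (e k) (ev phi y)).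
  have Pkap1 k phi : PW (kap1 k phi) by move=> x y y'; rewrite /kap1 tauDr fD.
  have Pkap2 k phi : PW (kap2 k phi).
    by move=> x y y'; rewrite /kap2 cevDr rYDr tauDr.
  have delta_single k phi : delta (single k phi) = pi (kap1 k phi) - pi (kap2 k phi).
    apply: (addIr (pi (kap2 k phi))); rewrite subrK -piD //; congr pi.
    apply/funext => x; apply/funext => y.
    change (dl (single k phi) x y + kap2 k phi x y = kap1 k phi x y).
    by rewrite /dl end_left_single end_right_single subrK.
  have R_Delta k t : R k (cDelta t) = \sum_(p <- rp t) beta (pi (kap1 k p.1)) p.2.
    rewrite {1}(rpE t) (additive_map_sum (@cDeltaD C)) (additive_map_sum (RD k)).
    apply: eq_bigr => -[x1 y1] _ /=; rewrite cDeltaE (additive_map_sum (RD k)).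
    under eq_bigr do rewrite RE.
    rewrite -(additive_map_sum (bDl' y1)) -pi_sum //; congr (beta (pi _) _).
    apply/funext => x; apply/funext => y; rewrite sumWE /kap1 -clTE fAl.
    rewrite -(additive_map_sum (@clTD C (ev x (e k)))); congr lT.
    rewrite -{2}(cdbY y) ctau_sumr (additive_map_sum fD).
    by apply: eq_bigr => l _; rewrite -crTE fAr.
  under eq_bigr => k _ do under eq_bigr => p _ do
    rewrite delta_single (additive_mapB (bDl' p.2)).
  under eq_bigr => k _ do rewrite sumrB -R_Delta gDelta cDeltaE (additive_map_sum gD)
    (additive_map_sum (RD k)).
  (* The index [l] of the comultiplication is matched with the summation index of the subtracted
     half. *)
  rewrite sumrB exchange_big -sumrB big1 //= => l _; apply/eqP; rewrite subr_eq0; apply/eqP.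
  under eq_bigr => k _ do rewrite gE {1}(rpE (h (tau (x_ l) y0)))
    (additive_map_sum (tau2Dr _)) (additive_map_sum (RD k)).
  rewrite exchange_big; apply: eq_bigr => -[phi m] _ /=.
  under eq_bigr do rewrite RE hK.
  rewrite -(additive_map_sum (bDl' m)) -pi_sum //; congr (beta (pi _) _).
  apply/funext => x; apply/funext => y; rewrite sumWE /kap2 -{2}(cdbX x) ctau_suml.
  by apply: eq_bigr => k _; rewrite -clTE -crTE.
(* The action S x M -> M is balanced, hence takes the same value on [w] and [w']; on [w] it gives
   [y0] because h preserves the counit. *)
have -> : y0 = \sum_(p <- w') end_left p.1 p.2.
  rewrite -ww'; last first.
    split=> [v v' y|v y y'|v b y] _ _ => [_|_|].
    - exact: end_leftDl.
    - exact: end_leftDr.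
    - exact: end_left_act.
  rewrite sum_w -[LHS]cdbY; apply: eq_bigr => k _.
  under eq_bigr do rewrite end_left_single.
  rewrite -(additive_map_sum (rYDr (e k))); congr rY.
  rewrite -cepsE -heps {1}(rpE (h _)) (additive_map_sum (@cepsD C)).
  by apply: eq_bigr => p _; rewrite cepsE.
apply: subgroup_sum => // p pw'.
exact/(Gtr _ _ _ (delta0 _ (w'0 _ pw'))).
Qed.

Lemma ff_descent : descent.
Proof. split; [exact: ff_equalizer | exact: ff_gen | exact: ff_ideal]. Qed.
End FaithfullyFlatDescent.

(** * Descent from a bimodule retraction of B -> S *)

Section SplitDescent.
Variable E : Y -> X -> B.
Hypothesis EDl : forall x, additive_map (E^~ x).
Hypothesis EDr : forall y, additive_map (E y).
Hypothesis EBl : forall b y x, E (lY b y) x = b * E y x.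
Hypothesis EBr : forall y x b, E y (rX x b) = E y x * b.
Hypothesis E1 : \sum_k E (e k) (x_ k) = 1.

(** [rho v] is the composite Sigma -> M (x)_A M^* (x)_B M -> B (x)_B M = M, where the first map is v
    (x) - and the second applies the retraction. *)
Lemma split_contract : exists rho : Y -> T -> Y,
  [/\ forall v, additive_map (rho v), forall v x y, rho v (tau x y) = lY (E v x) y
    & forall v t a, rho v (rT t a) = rY (rho v t) a].
Proof.
have [[lDr lDl lM l1] _ lrY] := cY_bimod C.
have /choice[rho rhoP] v : exists r : T -> Y,
    additive_map r /\ forall x y, r (tau x y) = lY (E v x) y.
  have [|r [rD rE _]] := (ctauP C).2 Y (fun x => lY (E v x)).
    by split=> *; rewrite ?EDr ?lDl ?lDr ?EBr ?lM.
  by exists r; split=> // *; exact: rE.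
exists rho; split=> [v|v|v]; [exact: (rhoP v).1 | exact: (rhoP v).2 |].
move=> t a; move: t; apply: (tensor_ext (ctauP C)).
- by move=> t u; rewrite crTD (rhoP v).1.
- by move=> t u; rewrite (rhoP v).1 rYDl.
- by move=> x y _ _; rewrite crTE !(rhoP v).2 lrY.
Qed.

Lemma split_descent : descent.
Proof.
have [[lDr lDl lM l1] _ lrY] := cY_bimod C.
have [rho [rhoD rhoE rhoA]] := split_contract.
split.
(* The witness is the value of the retraction at q = sum_k e_k (x) p(x_k). *)
- move=> p q [pq tpq]; exists (\sum_k E (e k) (p (x_ k))) => y.
  rewrite -[LHS]l1 -E1 !(additive_map_sum (lYDl _)).
  by apply: eq_bigr => k _; rewrite -!rhoE -tpq.
- move=> f h [fD fAl fAr feps [g [gD gE gDelta]]] _ fK hK G subG Gtr y.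
  (* Write q for this map. The map [R] below, t (x) u |-> x(rho v t) u, satisfies R Delta t = x (x)
     rho v t. At t = f (phi (x) z), compatibility of f with Delta turns x (x) q z into sum_l x(q
     e_l) f(x_l (x) z) = f (p x (x) z). *)
  have rho_f v phi : exists p, translator f p (fun y => rho v (f (tau phi y))).
    pose q y := rho v (f (tau phi y)).
    exists (fun x => \sum_l lX (ev x (q (e l))) (x_ l)); split=> [x z|x z].
      rewrite ev_suml -[in RHS](cdbY z) ctau_sumr !(additive_map_sum fD).
      rewrite (additive_map_sum (rhoD v)) ev_sumr; apply: eq_bigr => l _.
      by rewrite cevAl -crTE fAr rhoA cevAr.
    have [|R [RD RE _]] := (ctau2P C).2 T (fun t u => lT (ev x (rho v t)) u).
      split=> [t t' u|t u u'|t a u] _ _ => [_|_|].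
      - by rewrite rhoD cevDr lTDl.
      - by rewrite clTD.
      - by rewrite rhoA cevAr lTM.
    have RDelta t : R (cDelta t) = tau x (rho v t).
      move: t; apply: (tensor_ext (ctauP C)) => [t u|t u|x1 y1 _ _].
      - by rewrite cDeltaD RD.
      - by rewrite rhoD tauDr.
      rewrite cDeltaE (additive_map_sum RD) rhoE -tauB -[in RHS](cdbX (rX x _)) ctau_suml.
      by apply: eq_bigr => l _; rewrite RE // rhoE clTE cevB.
    rewrite -RDelta gDelta cDeltaE (additive_map_sum gD) (additive_map_sum RD).
    rewrite ctau_suml (additive_map_sum fD); apply: eq_bigr => l _.
    by rewrite gE RE // -clTE fAl.
  (* Each pure tensor phi (x) m in h (x_k (x) y) contributes rho e_k (f (phi (x) m)), the value at m
     of a translator of f. *)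
  rewrite -[y]l1 -E1 (additive_map_sum (lYDl y)).
  have -> : \sum_k lY (E (e k) (x_ k)) y = \sum_k rho (e k) (f (h (tau (x_ k) y))).
    by apply: eq_bigr => k _; rewrite hK rhoE.
  apply: subgroup_sum => // k _; have [w ->] := tau_expand (h (tau (x_ k) y)).
  rewrite (additive_map_sum fD) (additive_map_sum (rhoD _)).
  apply: subgroup_sum => // -[phi m] _.
  by have [p tp] := rho_f (e k) phi; exact: (Gtr _ _ _ tp).
(* As [E] is left B-linear and [D] is a right ideal, E(D M, x) lies in [D]; since D M = M, so does 1
   = sum_k E(e_k, x_k). *)
- move=> D subD DM Dgen.
  rewrite -E1; apply: subgroup_sum => // k _.
  have : forall y, D (E y (x_ k)).
    apply: Dgen => [|b y Db]; last by rewrite EBl; exact: DM.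
    split=> [|y y' Dy Dy']; first by rewrite (additive_map0 (EDl _)); exact: subD.1.
    by rewrite (additive_mapB (EDl _)); exact: subD.2.
  exact.
Qed.
End SplitDescent.

(** * Factorization of the identity *)

Lemma adjoint_additive (p : X -> X) (q : Y -> Y) : adjoint p q -> additive_map q.
Proof. by move=> pq y z; apply: ev_injr => x; rewrite cevDr -!pq cevDr. Qed.

Lemma adjoint_linear (p : X -> X) (q : Y -> Y) :
  adjoint p q -> forall y a, q (rY y a) = rY (q y) a.
Proof. by move=> pq y a; apply: ev_injr => x; rewrite cevAr -!pq cevAr. Qed.

(* Elements of [B] lying in [I_f I_h] form a right ideal [D] with [D Y = Y]. *)
Lemma descent_factor f h : descent ->
  coring_endo f -> coring_endo h -> cancel f h -> cancel h f ->
  forall G : (Y -> Y) -> Prop, subgroup G ->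
  (forall p q p' q', translator f p q -> translator h p' q' -> G (fun y => q (q' y))) ->
  G id.
Proof.
move=> [equalizer gen ideal] fcor hcor fK hK G subG Gtr.
have [[lDr lDl lM l1] _ lrY] := cY_bimod C.
(* Quantifying over [c] makes [D] a right ideal although [G] is only a subgroup. *)
pose D b := forall c, G (fun y => lY (b * c) y).
suff /(_ 1) : D 1.
  by congr (G _); apply/funext => y; rewrite mulr1 l1.
apply: ideal => [|b c Db d|G' subG' G'D].
- split=> [c|b b' Db Db' c].
    have -> : (fun y => lY (0 * c) y) = 0; last exact: subG.1.
    by apply/funext => y; rewrite mul0r (additive_map0 (lYDl y)).
  have -> : (fun y => lY ((b - b') * c) y) = (fun y => lY (b * c) y) - (fun y => lY (b' * c) y).
    by apply/funext => y; rewrite mulrBl (additive_mapB (lYDl y)).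
  exact: subG.2.
- by rewrite -mulrA; exact: Db.
(* From M = I_f M and M = I_h M, the values of the products q q' generate M. Each product is a
   translator of f h = 1, hence some b in [B], and b lies in [D] because q' c is again a translator
   of h. *)
apply: (gen _ _ fcor hcor fK hK) => // p q y tpq; move: y.
apply: (gen _ _ hcor fcor hK fK) => [|p' q' y tpq'].
  have q_add := adjoint_additive tpq.1.
  split=> [|y z Gy Gz]; first by rewrite (additive_map0 q_add); exact: subG'.1.
  by rewrite (additive_mapB q_add); exact: subG'.2.
have [b qb] : exists b, q \o q' =1 lY b.
  apply: (equalizer (p' \o p)); split=> x z /=; first by rewrite tpq'.1 tpq.1.
  by rewrite -tpq.2 -tpq'.2 hK.
rewrite -[q _]/((q \o q') y) qb; apply: G'D => c.
have -> : (fun y => lY (b * c) y) = (fun y => q (q' (lY c y))).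
  by apply/funext => z; rewrite lM -qb.
apply: (Gtr _ _ (fun x => rX (p' x) c) _ tpq); split=> [x z|x z].
  by rewrite cevB tpq'.1.
by rewrite tauB tpq'.2.
Qed.

End Comatrix.

(** * Transfer of descent from the opposite side *)

Section Duality.
Variable C : comatrix.
Local Notation X := (cX C).
Local Notation Y := (cY C).
Local Notation lY := (@clY C).
Local Notation ev := (@cev C).

Lemma coring_endo_conv (f : cT C -> cT C) :
  @coring_endo C f -> @coring_endo (comatrix_conv C) f.
Proof.
case=> fD fAl fAr feps [g [gD gE gDelta]]; apply: CoringEndo.
- exact: fD.
- by move=> a t; exact: fAr.
- by move=> t a; exact: fAl.
- exact: feps.
- by exists g; split=> // t u; exact: gE.
Qed.

Lemma equalizer_conv : descent (comatrix_conv C) ->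
  forall p q, translator id p q -> exists b, q =1 lY b.
Proof.
move=> Cc p q [pq tpq].
have [|b pb] := descent_equalizer Cc (p := q) (q := p).
  by split=> y x /=; [rewrite -pq | rewrite -tpq].
by exists b => y; apply: ev_injr => x; rewrite -pq (pb x) /= cevB.
Qed.

(** A translator of f on the opposite side satisfies f (x (x) q y) = p x (x) y; applying h shows
    that it is a translator of h on this side. Composition is reversed as well, so products in I_f
    I_h again come from products in I_f I_h. *)
Lemma factor_conv f h : descent (comatrix_conv C) ->
  coring_endo f -> coring_endo h -> cancel f h -> cancel h f ->
  forall G : (Y -> Y) -> Prop, subgroup G ->
  (forall p q p' q', translator f p q -> translator h p' q' -> G (fun y => q (q' y))) ->
  G id.
Proof.
move=> Cc fcor hcor fK hK G subG Gtr.
(* [G] is carried to endomorphisms of the dual along transposition. *)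
pose G' (p : X -> X) := exists2 q, adjoint p q & G q.
have [q idq Gq] : G' id.
  have fcor' := coring_endo_conv fcor; have hcor' := coring_endo_conv hcor.
  apply: (@descent_factor (comatrix_conv C) f h Cc fcor' hcor' fK hK G').
    split=> [|p p' [q pq Gq] [q' pq' Gq']].
      by exists 0 => [x y|]; [rewrite ev0l ev0r | exact: subG.1].
    exists (q - q') => [x y|]; last exact: subG.2.
    by rewrite (additive_mapB (cevDl y)) (additive_mapB (cevDr x)) pq pq'.
  move=> q p q' p' [/= qp tqp] [/= qp' tqp'].
  have pq x y : ev (p x) y = ev x (q y) by rewrite -[LHS]qp.
  have pq' x y : ev (p' x) y = ev x (q' y) by rewrite -[LHS]qp'.
  exists (fun y => q' (q y)) => [x y|]; first by rewrite pq pq'.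
  apply: (Gtr p' _ p).
    by split=> // x y; rewrite -tqp' hK.
  by split=> // x y; rewrite -tqp fK.
by rewrite (_ : id = q) //; apply/funext => y; apply: ev_injr => x; rewrite -idq.
Qed.
End Duality.

(** * The comatrix coring of a bimodule *)

Lemma rlinA0 (A : pzRingType) (M : zmodType) (rA : M -> A -> M) : rlinA rA (fun=> 0).
Proof. by split=> *; rewrite ?addr0 ?mul0r. Qed.

Lemma rlinAD (A : pzRingType) (M : zmodType) (rA : M -> A -> M) phi psi :
  rlinA rA phi -> rlinA rA psi -> rlinA rA (addfun phi psi).
Proof.
move=> [phiD phiA] [psiD psiA]; split=> [m m'|m a]; rewrite /addfun.
  by rewrite phiD psiD addrACA.
by rewrite phiA psiA mulrDl.
Qed.

Lemma rlinA_comp (A : pzRingType) (M : zmodType) (rA : M -> A -> M) phi s :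
  rlinA rA phi -> endA rA s -> rlinA rA (fun m => phi (s m)).
Proof. by move=> [phiD phiA] [sD sA]; split=> *; rewrite ?sD ?sA ?phiD ?phiA. Qed.

Lemma rlinA_scale (A : pzRingType) (M : zmodType) (rA : M -> A -> M) phi a :
  rlinA rA phi -> rlinA rA (fun m => a * phi m).
Proof. by move=> [phiD phiA]; split=> *; rewrite ?phiD ?phiA ?mulrDr ?mulrA. Qed.

Lemma endA_lB (A B : pzRingType) (M : zmodType) (lB : B -> M -> M) (rA : M -> A -> M) b :
  is_bimod lB rA -> endA rA (lB b).
Proof. by move=> [[lDr _ _ _] _ lr]; split=> *; rewrite ?lDr ?lr. Qed.

(** [comatrix] requires a type with a group structure, while M^* is given as the predicate [rlinA]
    on functions; [val] mediates between the two. *)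
Lemma dual_bimodule (A B : pzRingType) (M : zmodType) (lB : B -> M -> M) (rA : M -> A -> M) :
  is_bimod lB rA ->
  exists (X : zmodType) (val : X -> M -> A) (lX : A -> X -> X) (rX : X -> B -> X),
  [/\ is_bimod lX rX, injective val,
      forall phi, rlinA rA phi <-> exists x, val x = phi,
      forall x y, val (x + y) = addfun (val x) (val y) &
      (forall a x, val (lX a x) = fun m => a * val x m) /\
      (forall x b, val (rX x b) = fun m => val x (lB b m))].
Proof.
move=> HM; have [[lDr lDl lM l1] _ lr] := HM.
have [] := @subquotient (M -> A) (rlinA rA) (fun phi => phi = 0).
- exact: rlinA0.
- move=> phi psi [phiD phiA] [psiD psiA]; split=> [m m'|m a].
    by rewrite /= [LHS]/(phi (m + m') - psi (m + m')) phiD psiD opprD addrACA.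
  by rewrite [LHS]/(phi (rA m a) - psi (rA m a)) phiA psiA -[RHS]/((phi m - psi m) * a) mulrBl.
- by [].
- by move=> x y -> ->; rewrite subrr.
move=> X [pi [pi_surj piE piD]].
pose val x := s2val (cid2 (pi_surj x)).
have valP x : rlinA rA (val x) by exact: (s2valP (cid2 (pi_surj x))).
have valK x : pi (val x) = x by exact: (s2valP' (cid2 (pi_surj x))).
have piK phi : rlinA rA phi -> val (pi phi) = phi.
  by move=> Pphi; apply/subr0_eq/piE; rewrite ?valK.
have val_inj : injective val by exact: can_inj valK.
have valD x y : val (x + y) = addfun (val x) (val y).
  rewrite -{1}(valK x) -{1}(valK y) -piD // piK //.
  exact: (rlinAD (valP x) (valP y)).
pose lX a x := pi (fun m => a * val x m).
pose rX x b := pi (fun m => val x (lB b m)).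
have lXE a x : val (lX a x) = fun m => a * val x m by rewrite piK //; exact: rlinA_scale.
have rXE x b : val (rX x b) = fun m => val x (lB b m).
  by rewrite piK //; apply: rlinA_comp => //; exact: endA_lB HM.
exists X, val, lX, rX; split=> //.
  split; [split=> [a x y|a b x|a b x|x]|split=> [b x y|b c x|b c x|x]|move=> a x b];
    apply: val_inj; rewrite ?valD ?lXE ?rXE ?valD ?lXE ?rXE; apply/funext => m;
    rewrite /addfun ?mulrDr ?mulrDl ?mulrA ?mul1r ?lDl ?lM ?l1 //.
  by case: (valP x) => ->.
by move=> phi; split=> [Pphi|[x <-]//]; exists (pi phi); exact: piK.
Qed.

(** * Tensor products over a module given by a predicate *)

Section Restrict.
Variables (B : pzRingType) (U : Type) (PU : U -> Prop) (addU : U -> U -> U) (rU : U -> B -> U).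
Variables (X : zmodType) (val : X -> U) (rX : X -> B -> X).
Hypothesis val_inj : injective val.
Hypothesis valP : forall u, PU u <-> exists x, val x = u.
Hypothesis valD : forall x y, val (x + y) = addU (val x) (val y).
Hypothesis valB : forall x b, val (rX x b) = rU (val x) b.
Variables (Y : zmodType) (lY : B -> Y -> Y).

Let PUval x : PU (val x). Proof. by apply/valP; exists x. Qed.

Lemma balanced_restrict (Z : zmodType) (beta : U -> Y -> Z) :
  balanced PU (fun=> True) addU +%R rU lY beta <->
  balancedT rX lY (fun x => beta (val x)).
Proof.
split=> -[bDl bDr bA].
  by split=> [x x' y|x y y'|x r y] _ _ => [_|_|]; rewrite ?valD ?valB ?bDl ?bDr ?bA.
split=> [u u' y /valP[x <-] /valP[x' <-]|u y y' /valP[x <-]|u r y /valP[x <-]] _ => [|_|].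
- by rewrite -valD bDl.
- by rewrite bDr.
- by rewrite -valB bA.
Qed.

(** The value [z0] off the image of [val] is harmless: [balanced] and [is_tensor] test only elements
    satisfying [PU]. *)
Lemma extend_val (Z : Type) (z0 : Z) (t : X -> Y -> Z) :
  exists t' : U -> Y -> Z, forall x, t' (val x) = t x.
Proof.
have /choice[t' t'P] u : exists g : Y -> Z, forall x, val x = u -> g = t x.
  have [[x <-]|nx] := pselect (exists x, val x = u).
    by exists (t x) => x' /val_inj ->.
  by exists (fun=> z0) => x xu; case: nx; exists x.
by exists t' => x; exact: t'P.
Qed.

Lemma is_tensor_restrict (T : zmodType) (t : U -> Y -> T) :
  is_tensor PU (fun=> True) addU +%R rU lY t <->
  is_tensorT rX lY (fun x => t (val x)).
Proof.
split=> -[t_bal tU]; split; try exact/balanced_restrict.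
  move=> Z beta beta_bal; have [beta' beta'E] := extend_val 0 beta.
  have [|h [hD hE hU]] := tU Z beta'.
    by apply/balanced_restrict; rewrite (_ : (fun x => _) = beta) //; exact/funext.
  exists h; split=> // [x y _ _|h' h'D h'E]; first by rewrite hE // beta'E.
  by apply: hU => // u y /valP[x <-] _; rewrite h'E // beta'E.
move=> Z beta /balanced_restrict beta_bal.
have [h [hD hE hU]] := tU Z _ beta_bal.
exists h; split=> // [u y /valP[x <-] _|h' h'D h'E]; first exact: hE.
by apply: hU => // x y _ _; exact: h'E.
Qed.
End Restrict.

Lemma ff_right_conv (B : pzRingType) (U : Type) (PU : U -> Prop) (addU : U -> U -> U)
    (rU : U -> B -> U) (X : zmodType) (val : X -> U) (rX : X -> B -> X) :
  injective val -> (forall u, PU u <-> exists x, val x = u) ->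
  (forall x y, val (x + y) = addU (val x) (val y)) ->
  (forall x b, val (rX x b) = rU (val x) b) ->
  ff_right PU addU rU ->
  @ff_left B^c X (fun=> True) +%R (fun b x => rX x b).
Proof.
move=> val_inj valP valD valB [inj faithful]; split.
  move=> N1 N2 r1 r2 N1mod N2mod g gD gA gI T1 T2 t1 t2 t1T t2T h hD hE.
  have [t1' t1'E] := extend_val val_inj 0 (fun x y => t1 y x).
  have [t2' t2'E] := extend_val val_inj 0 (fun x y => t2 y x).
  apply: (inj N1 N2 (fun b x => r1 x b) (fun b x => r2 x b) _ _ g gD _ gI T1 T2 t1' t2') => //.
  - exact: (is_lmod_conv N1mod).
  - exact: (is_lmod_conv N2mod).
  - apply: (proj2 (is_tensor_restrict val_inj valP valD valB (fun b x => r1 x b) t1')).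
    rewrite (_ : (fun x => _) = fun x y => t1 y x); last exact/funext.
    exact: (is_tensor_conv t1T).
  - apply: (proj2 (is_tensor_restrict val_inj valP valD valB (fun b x => r2 x b) t2')).
    rewrite (_ : (fun x => _) = fun x y => t2 y x); last exact/funext.
    exact: (is_tensor_conv t2T).
  - by move=> u y /valP[x <-]; rewrite t1'E t2'E hE.
move=> N r Nmod T t tT T0.
have [t' t'E] := extend_val val_inj 0 (fun x y => t y x).
apply: (faithful N (fun b x => r x b) _ T t') => //.
- exact: (is_lmod_conv Nmod).
- apply: (proj2 (is_tensor_restrict val_inj valP valD valB (fun b x => r x b) t')).
  rewrite (_ : (fun x => _) = fun x y => t y x); last exact/funext.
  exact: (is_tensor_conv tT).
Qed.

(* A [B]-bimodule retraction [M (x)_A M^* -> B]: if [sigma 1 = sum m_i (x) f_i] then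
   [E y x = sum f_i (y (x m_i))]. *)
Lemma separable_split (C : comatrix) : separable_bimod (@clY C) (@crY C) ->
  exists E : cY C -> cX C -> cB C,
  [/\ forall x, additive_map (E^~ x), forall y, additive_map (E y),
      forall b y x, E (clY b y) x = b * E y x,
      forall y x b, E y (crX x b) = E y x * b &
      \sum_(k < cn C) E (ce k) (cx k) = 1].
Proof.
move=> [P [pi [Ptens [sigma [sD smu sl sr]]]]].
have [[lDr lDl lM l1] [rDl rDr rM r1] lr] := cY_bimod C.
have [piDl piDr piA] := Ptens.1.
have /choice[ev0 ev0P] yx : exists g : P -> cB C, additive_map g /\
    forall m f, llinB (@clY C) f -> g (pi m f) = f (crY yx.1 (cev yx.2 m)).
  case: yx => y x.
  have [|g [gD gE _]] := Ptens.2 _ (fun m f => f (crY y (cev x m))).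
    split=> [m m' f _ _ [fD _]|m f f' _ _ _|m a f _ _]; rewrite ?cevDr ?rDr ?fD //.
    by rewrite cevAr rM.
  by exists g; split=> // m f; exact: gE.
pose ev y x := ev0 (y, x).
have evD y x : additive_map (ev y x) by exact: (ev0P (y, x)).1.
have evE y x m f : llinB (@clY C) f -> ev y x (pi m f) = f (crY y (cev x m)).
  exact: (ev0P (y, x)).2.
exists (fun y x => ev y x (sigma 1)); split=> [x y y'|y x x'|b y x|y x b|].
- move: (sigma 1); apply: (tensor_ext Ptens) => [//|u v|m f _ Hf].
    by rewrite !evD addrACA.
  by rewrite !evE // rDl Hf.1.
- move: (sigma 1); apply: (tensor_ext Ptens) => [//|u v|m f _ Hf].
    by rewrite !evD addrACA.
  by rewrite !evE // cevDl rDr Hf.1.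
- move: (sigma 1); apply: (tensor_ext Ptens) => [//|u v|m f _ Hf].
    by rewrite evD mulrDr.
  by rewrite !evE // lr Hf.2.
(* [l] and [r] are the left and right multiplications by b on [P]. Both send sigma 1 to sigma b,
   which moves b from the argument of [E] to its right. *)
- have [|l [lD lE _]] := Ptens.2 P (fun m => pi (clY b m)).
    by split=> *; rewrite ?lDr ?piDl ?piDr -?lr ?piA.
  have llin_r f : llinB (@clY C) f -> llinB (@clY C) (fun x => f x * b).
    by move=> [fD fB]; split=> *; rewrite ?fD ?fB ?mulrDl ?mulrA.
  have [|r [rD rE _]] := Ptens.2 P (fun m f => pi m (fun x => f x * b)).
    split=> [m m' f _ _ Hf|m f f' _ Hf Hf'|m a f _ Hf].
    - by rewrite piDl //; exact: llin_r.
    - rewrite -piDr //; do ?exact: llin_r.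
      by congr (pi m _); apply/funext => z; rewrite /addfun mulrDl.
    - by rewrite piA //; exact: llin_r.
  have evl t : ev y (crX x b) t = ev y x (l t).
    move: t; apply: (tensor_ext Ptens) => [//|u v|m f _ Hf]; first by rewrite lD evD.
    by rewrite lE // !evE // cevB.
  have evr t : ev y x (r t) = ev y x t * b.
    move: t; apply: (tensor_ext Ptens) => [u v|u v|m f _ Hf].
    - by rewrite rD evD.
    - by rewrite evD mulrDl.
    by rewrite rE // !evE //; exact: llin_r.
  rewrite evl -evr -(sl b l lD) => [|m f Hf]; last by rewrite lE.
  rewrite -(sr b r rD) => [|m f Hf]; last by rewrite rE.
  by rewrite mulr1 mul1r.
(* By the dual basis identity this sum is the evaluation m (x) f |-> f m, which sigma splits. *)
- apply: (smu (fun t => \sum_k ev (ce k) (cx k) t)) => [u v|m f Hf].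
    by rewrite -big_split; apply: eq_bigr => k _; rewrite evD.
  under eq_bigr do rewrite evE //.
  by rewrite -{2}(cdbY m) (additive_map_sum Hf.1).
Qed.

(** * The isomorphism of groups *)

Section Main.
Variables (A B : pzRingType) (M : zmodType) (lB : B -> M -> M) (rA : M -> A -> M).
Hypothesis HM : is_bimod lB rA.
Variables (T : zmodType) (tau : (M -> A) -> M -> T).
Hypothesis HT : is_tensor (rlinA rA) (fun _ : M => True) addfun (@GRing.add M)
                  (fun phi b m => phi (lB b m)) lB tau.
Variables (ltA : A -> T -> T) (rtA : T -> A -> T).
Hypothesis HltA : forall a, additive_map (ltA a).
Hypothesis HrtA : forall a, additive_map (fun t => rtA t a).
Hypothesis HltAt : forall a phi m, rlinA rA phi ->
  ltA a (tau phi m) = tau (fun z => a * phi z) m.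
Hypothesis HrtAt : forall a phi m, rlinA rA phi -> rtA (tau phi m) a = tau phi (rA m a).
Variables (n : nat) (e : 'I_n -> M) (es : 'I_n -> M -> A).
Hypothesis Hes : forall k, rlinA rA (es k).
Hypothesis Hdb : forall m, m = \sum_(k < n) rA (e k) (es k m).
Variables (T2 : zmodType) (tau2 : T -> T -> T2).
Hypothesis HT2 : is_tensor (fun _ : T => True) (fun _ : T => True)
  (@GRing.add T) (@GRing.add T) rtA ltA tau2.
Variables (Delta : T -> T2).
Hypothesis HDa : additive_map Delta.
Hypothesis HDelta : forall phi m, rlinA rA phi ->
     Delta (tau phi m) = \sum_(k < n) tau2 (tau phi (e k)) (tau (es k) m).
Variables (eps : T -> A).
Hypothesis Hepsa : additive_map eps.
Hypothesis Heps : forall phi m, rlinA rA phi -> eps (tau phi m) = phi m.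

(* The subbimodule [I_f] of [S] corresponding to [f]. *)
Definition translations (f : T -> T) (s : M -> M) : Prop :=
  endA rA s /\ forall phi m, rlinA rA phi -> f (tau (fun z => phi (s z)) m) = tau phi (s m).

(** The three alternative hypotheses are used only here; afterwards they act through these two
    conclusions. *)
Lemma descent_translations :
  ff_left (fun _ : M => True) (@GRing.add M) lB \/
  ff_right (rlinA rA) addfun (fun phi b m => phi (lB b m)) \/
  separable_bimod lB rA ->
  (forall s, translations id s -> unit_sub lB s) /\
  (forall f h, coring_aut ltA rtA tau2 Delta eps f -> cancel f h -> cancel h f ->
     forall G : (M -> M) -> Prop, subgroup G ->
     (forall s t, translations f s -> translations h t -> G (fun m => s (t m))) -> G id).
Proof.
have [X [val [lX [rX [Xbim val_inj valP valD [lXE rXE]]]]]] := dual_bimodule HM.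
have Pval x : rlinA rA (val x) by apply/valP; exists x.
have /choice[xs xsE] k : exists x, val x = es k by exact/valP.
have cdbY m : \sum_k rA (e k) (val (xs k) m) = m.
  by rewrite [RHS]Hdb; apply: eq_bigr => k _; rewrite xsE.
have evDl m : additive_map (val^~ m) by move=> x y; rewrite valD.
have val_sum (F : 'I_n -> X) m : val (\sum_k F k) m = \sum_k val (F k) m.
  exact: (additive_map_sum (evDl m)).
have cdbX x : \sum_k lX (val x (e k)) (xs k) = x.
  apply: val_inj; apply/funext => m; rewrite val_sum -[in RHS](cdbY m).
  rewrite (additive_map_sum (Pval x).1); apply: eq_bigr => k _.
  by rewrite lXE (Pval x).2.
have tauP : is_tensorT rX lB (fun x => tau (val x)).
  exact: (proj1 (is_tensor_restrict val_inj valP valD rXE lB tau) HT).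
have evAl a x m : val (lX a x) m = a * val x m by rewrite lXE.
have evB x b m : val (rX x b) m = val x (lB b m) by rewrite rXE.
have lTE a x m : ltA a (tau (val x) m) = tau (val (lX a x)) m by rewrite HltAt // lXE.
have rTE a x m : rtA (tau (val x) m) a = tau (val x) (rA m a) by rewrite HrtAt.
have DE x m : Delta (tau (val x) m) = \sum_k tau2 (tau (val x) (e k)) (tau (val (xs k)) m).
  by rewrite HDelta //; apply: eq_bigr => k _; rewrite xsE.
have epsE x m : eps (tau (val x) m) = val x m by rewrite Heps.
pose C := @Comatrix A B X M lX rX lB rA Xbim HM val evDl (fun x => (Pval x).1) evAl
  (fun x => (Pval x).2) evB n e xs cdbY cdbX T (fun x => tau (val x)) tauP ltA rtA
  HltA HrtA lTE rTE T2 tau2 HT2 Delta HDa DE eps Hepsa epsE.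
move=> cases.
have dC : descent C \/ descent (comatrix_conv C).
  case: cases => [Yff|[Xff|sep]]; [left|right|left].
  - exact: (@ff_descent C Yff).
  - apply: (@ff_descent (comatrix_conv C)).
    exact: (ff_right_conv val_inj valP valD rXE Xff).
  - have [E [EDl EDr EBl EBr E1]] := @separable_split C sep.
    exact: (@split_descent C E EDl EDr EBl EBr E1).
have tr_to f p q : @translator C f p q -> translations f q.
  move=> tpq; split.
    split; [exact: (adjoint_additive tpq.1) | exact: (adjoint_linear tpq.1)].
  move=> phi m /valP[x <-]; rewrite -[RHS](tpq.2 x m); congr (f (tau _ m)).
  by apply/funext => z; exact: (esym (tpq.1 x z)).
have to_tr f s : translations f s -> exists p, @translator C f p s.
  move=> [sE fs].
  have /choice[p pE] x : exists y, val y = fun z => val x (s z).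
    by apply/valP; exact: rlinA_comp.
  exists p; split=> [x y|x y] /=; first by rewrite /= pE.
  by rewrite /= pE fs.
split=> [s /to_tr[p tps]|f h faut fK hK G subG Gtr].
  have [b sb] : exists b, s =1 lB b.
    case: dC => dC; first exact: (descent_equalizer dC tps).
    exact: (equalizer_conv dC tps).
  by exists b; exact/funext.
have fcor : @coring_endo C f.
  have [fD [_ [fl fr feps fDelta]]] := faut.
  split=> //.
  have [t2l t2r t2A] := HT2.1.
  have [|g [gD gE _]] := HT2.2 _ (fun t u => tau2 (f t) (f u)).
    by split=> *; rewrite ?fD ?fl ?fr ?t2l ?t2r ?t2A.
  exists g; split=> // [t u|]; first exact: gE.
  by apply: fDelta => // t u; exact: gE.
have hcor := coring_endo_inv fcor fK hK.
have GC p q p' q' : @translator C f p q -> @translator C h p' q' ->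
    G (fun y => q (q' y)).
  by move=> /tr_to tq /tr_to tq'; exact: Gtr.
case: dC => dC; first exact: (descent_factor dC fcor hcor fK hK subG GC).
exact: (factor_conv dC fcor hcor fK hK subG GC).
Qed.

Lemma tau_addl phi psi m : rlinA rA phi -> rlinA rA psi ->
  tau (addfun phi psi) m = tau phi m + tau psi m.
Proof. by have [tDl _ _] := HT.1 => ? ?; exact: tDl. Qed.

Lemma tau_addr phi : rlinA rA phi -> additive_map (tau phi).
Proof. by have [_ tDr _] := HT.1 => ? ? ?; exact: tDr. Qed.

Lemma tau0l m : tau (fun=> 0) m = 0.
Proof.
apply: (addIr (tau (fun=> 0) m)); rewrite -tau_addl; do ?exact: rlinA0.
by rewrite add0r; congr (tau _ m); apply/funext => z; rewrite /addfun addr0.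
Qed.

Lemma tau_suml r (F : 'I_r -> M -> A) m : (forall i, rlinA rA (F i)) ->
  tau (fun z => \sum_i F i z) m = \sum_i tau (F i) m.
Proof.
move=> FL; rewrite (_ : (fun z => _) = \sum_i F i); last first.
  apply/funext => z; apply/esym.
  exact: (additive_map_sum (f := fun g : M -> A => g z)).
suff [] : rlinA rA (\sum_i F i) /\ tau (\sum_i F i) m = \sum_i tau (F i) m by [].
elim/big_rec2: _ => [|i t g _ [gL <-]]; first by split; [exact: rlinA0 | exact: tau0l].
by split; [exact: rlinAD | rewrite tau_addl].
Qed.

Lemma tau_unit s phi m : unit_sub lB s -> rlinA rA phi ->
  tau (fun z => phi (s z)) m = tau phi (s m).
Proof. by move=> [b ->] Hphi; have [_ _ tA] := HT.1; exact: tA. Qed.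

Lemma endA0 : endA rA (fun=> 0).
Proof.
have [_ [rDl _ _ _] _] := HM; split=> [m m'|m a]; first by rewrite addr0.
by rewrite (additive_map0 (f := rA^~ a)) // => m' m''; exact: rDl.
Qed.

Lemma endAD s t : endA rA s -> endA rA t -> endA rA (fun m => s m + t m).
Proof.
have [_ [rDl _ _ _] _] := HM => -[sD sA] [tD tA].
by split=> *; rewrite ?sD ?tD ?sA ?tA ?rDl // addrACA.
Qed.

Lemma endA_comp s t : endA rA s -> endA rA t -> endA rA (fun m => s (t m)).
Proof. by move=> [sD sA] [tD tA]; split=> *; rewrite ?tD ?tA ?sD ?sA. Qed.

Lemma endA_sum s r (F : 'I_r -> M) : endA rA s -> s (\sum_i F i) = \sum_i s (F i).
Proof. by move=> [sD _]; exact: additive_map_sum. Qed.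

Lemma rlinA_sum phi r (F : 'I_r -> M) : rlinA rA phi -> phi (\sum_i F i) = \sum_i phi (F i).
Proof. by move=> [phiD _]; exact: additive_map_sum. Qed.

Lemma translationsD f s t : additive_map f ->
  translations f s -> translations f t -> translations f (fun m => s m + t m).
Proof.
move=> fD [sE fs] [tE ft]; split=> [|phi m Hphi]; first exact: endAD.
rewrite tau_addr // -fs // -ft // -fD -tau_addl; do ?exact: rlinA_comp.
by congr (f (tau _ m)); apply/funext => z; rewrite Hphi.1.
Qed.

Lemma translations0 f : additive_map f -> translations f (fun=> 0).
Proof.
move=> fD; split=> [|phi m Hphi]; first exact: endA0.
rewrite (additive_map0 (tau_addr Hphi)) (_ : (fun z => _) = fun=> 0); last first.
  by apply/funext => z; exact: (additive_map0 Hphi.1).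
by rewrite tau0l additive_map0.
Qed.

Lemma translations_sum f r (F : 'I_r -> M -> M) : additive_map f ->
  (forall i, translations f (F i)) -> translations f (fun m => \sum_i F i m).
Proof.
move=> fD Ff; rewrite (_ : (fun m => _) = \sum_i F i); last first.
  apply/funext => z; apply/esym.
  exact: (additive_map_sum (f := fun g : M -> M => g z)).
elim/big_rec: _ => [|i s _ fs]; first exact: translations0.
exact: (translationsD fD (Ff i) fs).
Qed.

Lemma translations_comp f g s t : translations f s -> translations g t ->
  translations (fun x => f (g x)) (fun m => s (t m)).
Proof.
move=> [sE fs] [tE gt]; split=> [|phi m Hphi]; first exact: endA_comp.
by rewrite (gt (fun z => phi (s z))) ?fs //; exact: rlinA_comp.
Qed.

Lemma translations_unit s : unit_sub lB s -> translations id s.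
Proof.
move=> us; split=> [|phi m Hphi]; last exact: tau_unit.
by have [b ->] := us; exact: endA_lB HM.
Qed.

Lemma translations_subbimod f : additive_map f -> subbimod lB rA (translations f).
Proof.
move=> fD; split=> [s []//||s t|b s fs|b s fs].
- exact: translations0.
- exact: translationsD.
- exact: (translations_comp (translations_unit (ex_intro _ b erefl)) fs).
- exact: (translations_comp fs (translations_unit (ex_intro _ b erefl))).
Qed.

Lemma prod_sub1 (I J : (M -> M) -> Prop) s t :
  I s -> J t -> prod_sub I J (fun m => s (t m)).
Proof.
move=> Is Jt; exists 1, (fun=> s), (fun=> t); split=> //.
by apply/funext => m; rewrite big_ord1.
Qed.

Lemma prod_sub_subgroup (I J : (M -> M) -> Prop) :
  (forall s, I s -> I (- s)) -> subgroup (prod_sub I J).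
Proof.
move=> IN; split.
  exists 0, (fun=> id), (fun=> id); split=> [[]//|[]//|].
  by apply/funext => m; rewrite big_ord0.
move=> _ _ [r [x [y [Ix Jy ->]]]] [r' [x' [y' [Ix' Jy' ->]]]].
exists (r + r')%N.
exists (fun k => match fintype.split k with inl i => x i | inr j => - x' j end).
exists (fun k => match fintype.split k with inl i => y i | inr j => y' j end).
split=> [k|k|]; first by case: fintype.split => j //; exact: IN.
  by case: fintype.split.
apply/funext => m; rewrite big_split_ord /=.
under [X in _ = X + _]eq_bigr do rewrite (unsplitK (inl _)).
under [X in _ = _ + X]eq_bigr do rewrite (unsplitK (inr _)).
by rewrite sumrN.
Qed.

(* [S I] contains [1]: enough for an additive map on [T] to be determined by its
   values on the [phi s (x) m] with [s] in [I]. *)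
Definition covers (I : (M -> M) -> Prop) : Prop := prod_sub (endA rA) I id.

Lemma covers_ext (I : (M -> M) -> Prop) (Z : zmodType) (F G : T -> Z) :
  (forall s, I s -> endA rA s) -> covers I -> additive_map F -> additive_map G ->
  (forall phi s m, rlinA rA phi -> I s ->
     F (tau (fun z => phi (s z)) m) = G (tau (fun z => phi (s z)) m)) ->
  forall t, F t = G t.
Proof.
move=> IE [r [x [y [xE Iy e1]]]] FD GD FG.
apply: (tensor_ext (f := F) (g := G) HT) => // phi m Hphi _.
have -> : phi = fun z => \sum_j phi (x j (y j z)).
  apply/funext => z; rewrite -(rlinA_sum _ Hphi).
  by congr phi; exact: (congr1 (fun g => g z) e1).
rewrite tau_suml => [|j]; last exact: (rlinA_comp (rlinA_comp Hphi (xE j)) (IE _ (Iy j))).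
rewrite !additive_map_sum //; apply: eq_bigr => j _.
by apply: (FG (fun z => phi (x j z))) => //; exact: rlinA_comp.
Qed.

(** Write phi = sum_j (phi x_j) y_j and let each y_j pass through f. Any decomposition of 1 in S I
    will do. *)
Lemma translations_expand (I : (M -> M) -> Prop) f r (x y : 'I_r -> M -> M) phi m :
  additive_map f -> (forall s, I s -> translations f s) ->
  (forall j, endA rA (x j)) -> (forall j, I (y j)) -> (forall m, \sum_j x j (y j m) = m) ->
  rlinA rA phi -> f (tau phi m) = \sum_j tau (fun z => phi (x j z)) (y j m).
Proof.
move=> fD If xE Iy xy1 Hphi.
have {1}-> : phi = fun z => \sum_j phi (x j (y j z)).
  by apply/funext => z; rewrite -(rlinA_sum _ Hphi) xy1.
rewrite tau_suml => [|j]; last exact: (rlinA_comp (rlinA_comp Hphi (xE j)) (If _ (Iy j)).1).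
rewrite additive_map_sum //; apply: eq_bigr => j _.
by rewrite ((If _ (Iy j)).2 (fun z => phi (x j z))) //; exact: rlinA_comp.
Qed.

Lemma Gamma0_of_translations (I : (M -> M) -> Prop) f : covers I -> additive_map f ->
  (forall s, I s -> translations f s) -> Gamma0 rA tau I f.
Proof.
move=> [r [x [y [xE Iy e1]]]] fD If.
have xy1 m : \sum_j x j (y j m) = m by exact: (esym (congr1 (fun g => g m) e1)).
exists r, x, y; split=> // phi m Hphi.
exact: (translations_expand m fD If xE Iy xy1 Hphi).
Qed.

(** For 1 = sum_j x_j y_j in J I, f sends phi (x) m to sum_j phi x_j (x) y_j m, and h then moves
    each x_j to the right. *)
Lemma translations_cancel (I J : (M -> M) -> Prop) f h : prod_sub J I id ->
  additive_map f -> additive_map h ->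
  (forall s, I s -> translations f s) -> (forall s, J s -> translations h s) ->
  cancel f h.
Proof.
move=> [r [x [y [Jx Iy e1]]]] fD hD If Jh; have xE j := (Jh _ (Jx j)).1.
have xy1 m : \sum_j x j (y j m) = m by exact: (esym (congr1 (fun g => g m) e1)).
apply: (tensor_ext (f := fun t => h (f t)) (g := id) HT) => // [u v|phi m Hphi _].
  by rewrite fD hD.
rewrite (translations_expand m fD If xE Iy xy1 Hphi) (additive_map_sum hD).
under eq_bigr => j _ do rewrite (Jh _ (Jx j)).2 //.
by rewrite -(additive_map_sum (tau_addr Hphi)) xy1.
Qed.

(** Insert 1 = sum_l c_l d_l after t: the product y_j t c_l lies in I J, hence in [B], and crosses
    the tensor sign, where sum_j x_j y_j = 1 absorbs it. Taking t = 1 compares two decompositions of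
    1; taking t in [B] shows that the formula is balanced. *)
Lemma slide (I J : (M -> M) -> Prop) r (c d : 'I_r -> M -> M) r' (x y : 'I_r' -> M -> M)
    (t : M -> M) phi m :
  (forall s, J s -> endA rA s) ->
  (forall s s', I s -> J s' -> unit_sub lB (fun m => s (s' m))) ->
  (forall l, J (c l)) -> (forall m, \sum_l c l (d l m) = m) ->
  (forall j, endA rA (x j)) -> (forall j, endA rA (y j)) ->
  (forall m, \sum_j x j (y j m) = m) ->
  endA rA t -> (forall j, I (fun m => y j (t m))) -> rlinA rA phi ->
  \sum_j tau (fun z => phi (x j z)) (y j (t m)) =
  \sum_l tau (fun z => phi (t (c l z))) (d l m).
Proof.
move=> JE IJ Jc cd1 xE yE xy1 tE Iyt Hphi.
transitivity (\sum_j \sum_l tau (fun z => phi (x j (y j (t (c l z))))) (d l m)).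
  apply: eq_bigr => j _; have Hphix := rlinA_comp Hphi (xE j).
  rewrite -{1}(cd1 m) (endA_sum _ tE) (endA_sum _ (yE j)).
  rewrite (additive_map_sum (tau_addr Hphix)); apply: eq_bigr => l _.
  exact: (esym (tau_unit _ (IJ _ _ (Iyt j) (Jc l)) Hphix)).
rewrite exchange_big; apply: eq_bigr => l _ /=.
rewrite -tau_suml => [|j].
  by congr (tau _ _); apply/funext => z; rewrite -(rlinA_sum _ Hphi) xy1.
apply: (rlinA_comp (s := fun z => x j (y j (t (c l z))))) => //.
by do 3?[apply: endA_comp => //]; exact: JE.
Qed.

Lemma InvB_data I : InvB lB rA I -> exists (J : (M -> M) -> Prop) r (c d : 'I_r -> M -> M),
  [/\ subbimod lB rA J, forall s t, I s -> J t -> unit_sub lB (fun m => s (t m)),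
      (forall l, J (c l)) /\ (forall l, I (d l)), forall m, \sum_l c l (d l m) = m
    & InvB lB rA J].
Proof.
move=> [IS [J [JS IJ JI]]].
have [[_ _ _ l1] _ _] := HM.
have [r [c [d [Jc Id e1]]]] := (JI _).2 (ex_intro _ 1 erefl).
exists J, r, c, d; split=> // [s t Is Jt|m|].
- by apply/IJ; exact: prod_sub1.
- by rewrite -[RHS]l1 e1.
- by split=> //; exists I; split.
Qed.

Lemma id_unit : unit_sub lB id.
Proof.
have [[_ _ _ l1] _ _] := HM.
by exists 1; apply/funext => m; rewrite l1.
Qed.

Lemma InvB_covers I : InvB lB rA I -> covers I.
Proof.
move=> [_ [J [[JE _ _ _ _] _ JI]]].
have [r [x [y [Jx Iy e1]]]] := (JI _).2 id_unit.
by exists r, x, y; split=> // j; exact: JE.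
Qed.

Lemma translations_formula (I J : (M -> M) -> Prop) r (c d : 'I_r -> M -> M) f :
  subbimod lB rA I -> subbimod lB rA J ->
  (forall s t, I s -> J t -> unit_sub lB (fun m => s (t m))) ->
  (forall l, J (c l)) -> (forall m, \sum_l c l (d l m) = m) ->
  (forall phi m, rlinA rA phi ->
     f (tau phi m) = \sum_l tau (fun z => phi (c l z)) (d l m)) ->
  forall s, I s -> translations f s.
Proof.
move=> [IE _ _ _ _] [JE _ _ _ _] IJ Jc cd1 fE s Is; split=> [|phi m Hphi]; first exact: IE.
rewrite fE; last exact: (rlinA_comp Hphi (IE _ Is)).
rewrite -{2}(cd1 m) (endA_sum _ (IE _ Is)) (additive_map_sum (tau_addr Hphi)).
by apply: eq_bigr => l _; exact: (tau_unit _ (IJ _ _ Is (Jc l)) Hphi).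
Qed.

Lemma Gamma0_translations I f : InvB lB rA I -> Gamma0 rA tau I f ->
  additive_map f /\ forall s, I s -> translations f s.
Proof.
move=> Iinv [r' [x [y [xE Iy xy1 fD fE]]]]; split=> //.
have [J [r [c [d [JS IJ [Jc _] cd1 _]]]]] := InvB_data Iinv.
have [IS _] := Iinv; have [IE _ _ _ _] := IS; have [JE _ _ _ _] := JS.
apply: (translations_formula (d := d) IS JS IJ Jc cd1) => phi m Hphi; rewrite fE //.
by apply: (slide (t := id) m JE IJ Jc cd1 xE _ xy1) => // j; exact: IE.
Qed.

Lemma InvB_map I : InvB lB rA I ->
  exists2 f, additive_map f & forall s, I s -> translations f s.
Proof.
move=> Iinv; have [J [r [c [d [JS IJ [Jc Id] cd1 _]]]]] := InvB_data Iinv.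
have [IS _] := Iinv; have [IE _ _ _ Ib] := IS; have [JE _ _ _ _] := JS.
have dE l := IE _ (Id l); have cE l := JE _ (Jc l).
have [|f [fD fE _]] := HT.2 T (fun phi m => \sum_l tau (fun z => phi (c l z)) (d l m)).
  split=> [phi psi m Hphi Hpsi _|phi m m' Hphi _ _|phi b m Hphi _].
  - rewrite -big_split; apply: eq_bigr => l _ /=.
    by rewrite -tau_addl //; exact: rlinA_comp.
  - rewrite -big_split; apply: eq_bigr => l _ /=.
    by rewrite (dE l).1 tau_addr //; exact: rlinA_comp.
  - apply/esym; apply: (slide (t := lB b) m JE IJ Jc cd1 cE dE cd1) => //.
      exact: endA_lB HM.
    by move=> l; exact: Ib.
exists f => //.
by apply: (translations_formula (d := d) IS JS IJ Jc cd1) => phi m Hphi; exact: fE.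
Qed.

Lemma coring_aut_of_translations (I : (M -> M) -> Prop) f : covers I ->
  additive_map f -> bijective f -> (forall s, I s -> translations f s) ->
  coring_aut ltA rtA tau2 Delta eps f.
Proof.
move=> Icov fD fbij If; have IE s Is := (If s Is).1.
have [_ _ t2A] := HT2.1.
have t2l u : additive_map (tau2^~ u) by have [t2 _ _] := HT2.1 => t t'; exact: t2.
have t2r u : additive_map (tau2 u) by have [_ t2 _] := HT2.1 => t t'; exact: t2.
have fl a t : f (ltA a t) = ltA a (f t).
  move: t; apply: (covers_ext IE Icov) => [u v|u v|phi s m Hphi Is].
  - by rewrite HltA fD.
  - by rewrite fD HltA.
  rewrite HltAt; last exact: (rlinA_comp Hphi (IE _ Is)).
  rewrite ((If _ Is).2 phi) // ((If _ Is).2 (fun z => a * phi z)) ?HltAt //.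
  exact: rlinA_scale.
split=> //; split=> //; split=> //.
- move=> a; apply: (covers_ext IE Icov) => [u v|u v|phi s m Hphi Is].
  + by rewrite HrtA fD.
  + by rewrite fD HrtA.
  rewrite HrtAt; last exact: (rlinA_comp Hphi (IE _ Is)).
  by rewrite !(If _ Is).2 // (IE _ Is).2 HrtAt.
- apply: (covers_ext IE Icov) => [u v|//|phi s m Hphi Is]; first by rewrite fD Hepsa.
  rewrite (If _ Is).2 // !Heps //; exact: (rlinA_comp Hphi (IE _ Is)).
- move=> g gD gE; apply: (covers_ext IE Icov) => [u v|u v|phi s m Hphi Is].
  + by rewrite fD HDa.
  + by rewrite HDa gD.
  have Hphis := rlinA_comp Hphi (IE _ Is).
  rewrite (If _ Is).2 // !HDelta // (additive_map_sum gD).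
  (* The vector s e_k is expanded in the dual basis, and its coefficients are moved across the
     tensor over A. The sum over k then folds back through e_i^* s = sum_k e_i^*(s e_k) e_k^*, and f
     turns e_i^* s (x) m into e_i^* (x) s m. *)
  transitivity (\sum_k \sum_i
      tau2 (tau phi (e i)) (ltA (es i (s (e k))) (f (tau (es k) m)))); last first.
    apply: eq_bigr => k _; rewrite gE (If _ Is).2 // [in RHS](Hdb (s (e k))).
    rewrite (additive_map_sum (tau_addr Hphi)).
    rewrite (additive_map_sum (t2l (f (tau (es k) m)))).
    by apply: eq_bigr => i _; rewrite -HrtAt // t2A.
  rewrite exchange_big; apply: eq_bigr => i _ /=.
  rewrite -(additive_map_sum (t2r _)); congr tau2.
  have Hesi := rlinA_comp (Hes i) (IE _ Is).
  rewrite -(If _ Is).2 //.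
  have -> : (fun z => es i (s z)) = fun z => \sum_k es i (s (e k)) * es k z.
    apply/funext => z; rewrite {1}(Hdb z) (rlinA_sum _ Hesi).
    by apply: eq_bigr => k _; rewrite Hesi.2.
  rewrite tau_suml => [|k]; last exact: rlinA_scale.
  rewrite (additive_map_sum fD); apply: eq_bigr => k _.
  by rewrite -HltAt // fl.
Qed.

Lemma endAN s : endA rA s -> endA rA (- s).
Proof.
have [_ [rDl _ _ _] _] := HM => -[sD sA].
have rN a m : rA (- m) a = - rA m a.
  by apply: (@additive_mapN _ _ (rA^~ a)) => m' m''; exact: rDl.
split=> [m m'|m a]; rewrite -[LHS]/(- s _); first by rewrite sD opprD.
by rewrite sA -rN.
Qed.

Lemma translationsN f s : additive_map f -> translations f s -> translations f (- s).
Proof.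
move=> fD [sE fs]; split=> [|phi m Hphi]; first exact: endAN.
rewrite -[(- s) m]/(- s m) (additive_mapN (tau_addr Hphi)) -fs // -additive_mapN //.
congr f; apply: (addIr (tau (fun z => phi (s z)) m)); rewrite addNr -tau_addl.
- rewrite -[RHS](tau0l m); congr (tau _ m); apply/funext => z.
  by rewrite /addfun -Hphi.1 addNr (additive_map0 Hphi.1).
- exact: (rlinA_comp Hphi (endAN sE)).
- exact: (rlinA_comp Hphi sE).
Qed.

Lemma subbimod_sum I r (F : 'I_r -> M -> M) : subbimod lB rA I ->
  (forall k, I (F k)) -> I (fun m => \sum_k F k m).
Proof.
move=> [_ I0 ID _ _] IF; rewrite (_ : (fun m => _) = \sum_i F i); last first.
  apply/funext => z; apply/esym.
  exact: (additive_map_sum (f := fun g : M -> M => g z)).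
elim/big_rec: _ => [|i s _ Is]; first exact: I0.
exact: (ID _ _ (IF i) Is).
Qed.

Lemma Gamma0_exists I : InvB lB rA I ->
  exists f, Gamma0 rA tau I f /\ coring_aut ltA rtA tau2 Delta eps f.
Proof.
move=> Iinv; have Icov := InvB_covers Iinv; have [IS [J [JS IJ JI]]] := Iinv.
have [f fD If] := InvB_map Iinv.
have [|h hD Jh] := @InvB_map J; first by split=> //; exists I; split.
have fK : cancel f h by apply: (translations_cancel _ fD hD If Jh); apply/JI; exact: id_unit.
have hK : cancel h f by apply: (translations_cancel _ hD fD Jh If); apply/IJ; exact: id_unit.
exists f; split; first exact: Gamma0_of_translations.
by apply: (coring_aut_of_translations Icov) => //; exists h.
Qed.

Lemma Gamma0_unique I f g : InvB lB rA I ->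
  Gamma0 rA tau I f -> Gamma0 rA tau I g -> f = g.
Proof.
move=> Iinv /(Gamma0_translations Iinv)[fD If] /(Gamma0_translations Iinv)[gD Ig].
apply/funext; apply: (covers_ext _ (InvB_covers Iinv) fD gD) => [s /If[]//|phi s m Hphi Is].
by rewrite (If _ Is).2 // (Ig _ Is).2.
Qed.

Lemma Gamma0_comp I J f g : InvB lB rA I -> InvB lB rA J ->
  Gamma0 rA tau I f -> Gamma0 rA tau J g ->
  Gamma0 rA tau (prod_sub I J) (fun t => f (g t)).
Proof.
move=> Iinv Jinv /(Gamma0_translations Iinv)[fD If] /(Gamma0_translations Jinv)[gD Jg].
have fgD : additive_map (fun t => f (g t)) by move=> u v; rewrite gD fD.
apply: Gamma0_of_translations => // [|_ [r [x [y [Ix Jy ->]]]]]; last first.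
  apply: translations_sum => // k.
  exact: (translations_comp (If _ (Ix k)) (Jg _ (Jy k))).
have [r [x [y [xE Iy xy1]]]] := InvB_covers Iinv.
have [r' [x' [y' [x'E Jy' xy1']]]] := InvB_covers Jinv.
rewrite /covers.
(* The decomposition for [I] is inserted in the middle of that for [J], so that x'_k x_j lies in S
   and y_j y'_k in I J. *)
have -> : id = \sum_k \sum_j (fun m => x' k (x j (y j (y' k m)))).
  apply/funext => m.
  rewrite (additive_map_sum (f := fun g : M -> M => g m)) //.
  rewrite [LHS](congr1 (fun g => g m) xy1').
  apply: eq_bigr => k _.
  rewrite (additive_map_sum (f := fun g : M -> M => g m)) //.
  by rewrite -(endA_sum _ (x'E k)); congr (x' k _); exact: (congr1 (fun g => g _) xy1).
apply: subgroup_sum => [|k _]; first exact/prod_sub_subgroup/endAN.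
apply: subgroup_sum => [|j _]; first exact/prod_sub_subgroup/endAN.
apply: (@prod_sub1 _ _ (fun m => x' k (x j m)) (fun m => y j (y' k m))).
  exact: endA_comp.
exact: prod_sub1.
Qed.

(** * Injectivity and surjectivity *)

Hypothesis equalizer : forall s, translations id s -> unit_sub lB s.

(** Let K be the inverse of J and 1 = sum_l c_l d_l in K J. Each s c_l is a translation for f h = 1,
    hence lies in [B], so s = sum_l (s c_l) d_l lies in B J = J. *)
Lemma Gamma0_sub I J f : InvB lB rA I -> InvB lB rA J ->
  Gamma0 rA tau I f -> Gamma0 rA tau J f -> forall s, I s -> J s.
Proof.
move=> Iinv Jinv /(Gamma0_translations Iinv)[fD If] /(Gamma0_translations Jinv)[_ Jf] s Is.
have [JS [K [KS JK KJ]]] := Jinv.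
have [|h hD Kh] := @InvB_map K; first by split=> //; exists J; split.
have hK : cancel h f by apply: (translations_cancel _ hD fD Kh Jf); apply/JK; exact: id_unit.
have [r [c [d [Kc Jd cd1]]]] := (KJ _).2 id_unit.
have -> : s = fun m => \sum_l s (c l (d l m)).
  apply/funext => m; rewrite -(endA_sum _ (If _ Is).1).
  by congr s; exact: (congr1 (fun g => g m) cd1).
apply: subbimod_sum => // l.
have [b sc] : unit_sub lB (fun m => s (c l m)).
  apply: equalizer; rewrite (_ : id = fun t => f (h t)); last by apply/funext => t; rewrite hK.
  exact: (translations_comp (If _ Is) (Kh _ (Kc l))).
have -> : (fun m => s (c l (d l m))) = fun m => lB b (d l m).
  by apply/funext => m; exact: (congr1 (fun g => g (d l m)) sc).
by have [_ _ _ Jb _] := JS; exact: Jb.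
Qed.

Hypothesis factor : forall f h, coring_aut ltA rtA tau2 Delta eps f ->
  cancel f h -> cancel h f -> forall G : (M -> M) -> Prop, subgroup G ->
  (forall s t, translations f s -> translations h t -> G (fun m => s (t m))) -> G id.

Lemma translations_prod f h : coring_aut ltA rtA tau2 Delta eps f -> additive_map h ->
  cancel f h -> cancel h f ->
  forall s, prod_sub (translations f) (translations h) s <-> unit_sub lB s.
Proof.
move=> faut hD fK hK s; have fD := faut.1.
have idD : additive_map (@id T) by [].
split=> [[r [x [y [fx hy ->]]]]|[b ->]].
  apply/equalizer/translations_sum => // k.
  rewrite (_ : id = fun t => f (h t)); last by apply/funext => t; rewrite hK.
  exact: translations_comp.
have [r [x [y [fx hy e1]]]] : prod_sub (translations f) (translations h) id.
  apply: (factor faut fK hK) => [|s' t fs ht]; last exact: prod_sub1.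
  by apply: prod_sub_subgroup => t; exact: translationsN.
(* The factorization of 1, multiplied by b on the left. *)
exists r, (fun k m => lB b (x k m)), y; split=> // [k|].
  by have [_ _ _ fb _] := translations_subbimod fD; exact: fb.
apply/funext => m; rewrite -(endA_sum _ (endA_lB b HM)).
by congr (lB b); exact: (congr1 (fun g => g m) e1).
Qed.

Lemma Gamma0_surj f : coring_aut ltA rtA tau2 Delta eps f ->
  exists I, InvB lB rA I /\ Gamma0 rA tau I f.
Proof.
move=> faut; have [fD [[h fK hK] _]] := faut.
have hD : additive_map h by move=> t u; rewrite -{1}(hK t) -{1}(hK u) -fD fK.
have covers_inv g k : prod_sub (translations g) (translations k) id -> covers (translations k).
  move=> [r [x [y [gx ky e1]]]]; exists r, x, y; split=> // j; exact: (gx j).1.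
have fh := translations_prod faut hD fK hK.
(* As 1 lies in I_f I_h, the translations of h cover, which makes h an automorphism too; the
   products can then be taken in the other order. *)
have haut : coring_aut ltA rtA tau2 Delta eps h.
  apply: (@coring_aut_of_translations (translations h)) => //; last by exists f.
  by apply: (covers_inv f); apply/fh; exact: id_unit.
have hf := translations_prod haut fD hK fK.
exists (translations f); split; last first.
  apply: Gamma0_of_translations => //.
  by apply: (covers_inv h); apply/hf; exact: id_unit.
split; first exact: translations_subbimod.
exists (translations h); split=> //; exact: translations_subbimod.
Qed.
End Main.

Theorem theorem3p15 (A B : pzRingType) (M : zmodType)
  (lB : B -> M -> M) (rA : M -> A -> M)
  (HM : is_bimod lB rA) (Hfgp : fg_projective rA)
  (* Sigma = M^* (x)_B M, with tau phi m = phi (x) m *)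
  (T : zmodType) (tau : (M -> A) -> M -> T)
  (HT : is_tensor (rlinA rA) (fun _ : M => True) addfun (@GRing.add M)
                  (fun phi b m => phi (lB b m)) lB tau)
  (* the A-bimodule structure of Sigma *)
  (ltA : A -> T -> T) (rtA : T -> A -> T)
  (HltA : forall a, additive_map (ltA a))
  (HrtA : forall a, additive_map (fun t => rtA t a))
  (HltAt : forall a phi m, rlinA rA phi -> ltA a (tau phi m) = tau (fun z => a * phi z) m)
  (HrtAt : forall a phi m, rlinA rA phi -> rtA (tau phi m) a = tau phi (rA m a))
  (* a dual basis {e_k, e_k^*} of M_A *)
  (n : nat) (e : 'I_n -> M) (es : 'I_n -> M -> A)
  (Hes : forall k, rlinA rA (es k))
  (Hdb : forall m, m = \sum_(k < n) rA (e k) (es k m))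
  (* Sigma (x)_A Sigma *)
  (T2 : zmodType) (tau2 : T -> T -> T2)
  (HT2 : is_tensor (fun _ : T => True) (fun _ : T => True) (@GRing.add T) (@GRing.add T)
                   rtA ltA tau2)
  (* comultiplication and counit *)
  (Delta : T -> T2) (HDa : additive_map Delta)
  (HDelta : forall phi m, rlinA rA phi ->
     Delta (tau phi m) = \sum_(k < n) tau2 (tau phi (e k)) (tau (es k) m))
  (eps : T -> A) (Hepsa : additive_map eps)
  (Heps : forall phi m, rlinA rA phi -> eps (tau phi m) = phi m) :
  ff_left (fun _ : M => True) (@GRing.add M) lB \/
  ff_right (rlinA rA) addfun (fun phi b m => phi (lB b m)) \/
  separable_bimod lB rA ->
  (* Gamma_0 : Inv_B(S) -> Aut_{A-cor}(Sigma) is a well-defined map ... *)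
  (forall I, InvB lB rA I ->
     exists f, Gamma0 rA tau I f /\ coring_aut ltA rtA tau2 Delta eps f) /\
  (forall I f g, InvB lB rA I -> Gamma0 rA tau I f -> Gamma0 rA tau I g -> f = g) /\
  (* ... which is a group homomorphism ... *)
  (forall I J f g, InvB lB rA I -> InvB lB rA J ->
     Gamma0 rA tau I f -> Gamma0 rA tau J g ->
     Gamma0 rA tau (prod_sub I J) (fun t => f (g t))) /\
  (* ... injective ... *)
  (forall I J f, InvB lB rA I -> InvB lB rA J ->
     Gamma0 rA tau I f -> Gamma0 rA tau J f -> forall s, I s <-> J s) /\
  (* ... and surjective *)
  (forall f, coring_aut ltA rtA tau2 Delta eps f ->
     exists I, InvB lB rA I /\ Gamma0 rA tau I f).
Proof.
move=> cases.
have [equalizer factor] := descent_translations HM HT HltA HrtA HltAt HrtAt Hes Hdb HT2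
  HDa HDelta Hepsa Heps cases.
split; [|split; [|split; [|split]]].
- move=> I Iinv.
  exact: (Gamma0_exists HM HT HltA HrtA HltAt HrtAt Hes Hdb HT2 HDa HDelta Hepsa Heps).
- by move=> I f g; exact: (Gamma0_unique HM HT).
- by move=> I J f g; exact: (Gamma0_comp HM HT).
- move=> I J f Iinv Jinv If Jf s; split; [exact: (Gamma0_sub HM HT equalizer Iinv Jinv If Jf) |].
  exact: (Gamma0_sub HM HT equalizer Jinv Iinv Jf If).
- exact: (Gamma0_surj HM HT HltA HrtA HltAt HrtAt Hes Hdb HT2 HDa HDelta Hepsa Heps
    equalizer factor).
Qed.
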